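(* Fix a capacity $c\in\{1,2,\dots\}\cup\{\infty\}$, an integer $d\ge 1$, and an initial configuration $\zeta_0\in\{0,1\}^{\mathbb N}$ with exactly $d$ balls (independent of $\varepsilon$). For $\varepsilon\in(0,1)$ let $(\zeta_t)_{t\ge 0}$ be the SBBS with error probability $\varepsilon$ and capacity $c$ started from $\zeta_0$, and define the continuous-time process $\zeta^\varepsilon=(\zeta^\varepsilon_1,\dots,\zeta^\varepsilon_d)$ by $\zeta^\varepsilon_i(t)=\zeta^{(i)}_{\lfloor t/(1-\varepsilon)\rfloor}$ (position of the $i$-th ball from the left at time $\lfloor t/(1-\varepsilon)\rfloor$), $t\ge 0$. Then, as $\varepsilon\nearrow 1$, $\zeta^\varepsilon$ converges in distribution, in the Skorokhod space $D([0,\infty),\mathbb Z^d)$, to the $d$-particle PushTASEP started from the particle positions $\zeta^{(1)}_0<\dots<\zeta^{(d)}_0$.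
   Context: Stochastic box-ball system (SBBS). Fix an error probability $\varepsilon\in[0,1]$ and a capacity $c\in\{1,2,\dots\}\cup\{\infty\}$. A configuration is $\zeta\in\{0,1\}^{\mathbb N}$, $\mathbb N=\{1,2,\dots\}$, with finitely many $1$'s (balls; site $k$ holds a ball iff $\zeta(k)=1$). Given $\zeta$, the stochastic carrier process $\Gamma:\{0,1,2,\dots\}\to\mathbb Z_{\ge0}$ is defined by $\Gamma(0)=0$ and recursively (with fresh independent randomness at each $k$): $\Gamma(k)=\Gamma(k-1)+1$ with probability $1-\varepsilon$ (and $\Gamma(k)=\Gamma(k-1)$ with probability $\varepsilon$) if $\zeta(k)=1$ and $\Gamma(k-1)<c$; $\Gamma(k)=\Gamma(k-1)-1$ if $\zeta(k)=0$ and $\Gamma(k-1)\ge1$; $\Gamma(k)=\Gamma(k-1)$ otherwise. The new configuration is $\zeta'(k)=\mathbf 1(\Gamma(k)-\Gamma(k-1)=-1)+\mathbf 1(\Gamma(k)=\Gamma(k-1),\ \zeta(k)=1)$. Iterating this random map independently gives the SBBS trajectory $(\zeta_t)_{t\in\mathbb Z_{\ge0}}$. Equivalently, at each time $t$ there are i.i.d. coins $\eta^{(1)}_t,\dots,\eta^{(d)}_t\sim\mathrm{Bernoulli}(1-\varepsilon)$, independent over $t$, and when the carrier sweeping $\zeta_t$ reaches the $i$-th ball from the left it picks it up iff $\eta_t^{(i)}=1$ and its current load is $<c$. The number $d$ of balls is conserved; $\zeta^{(1)}_t<\dots<\zeta^{(d)}_t$ denote the ball positions at time $t$. PushTASEP: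 a continuous-time process of $d$ particles at distinct sites of $\mathbb Z$, each particle carrying an independent rate-$1$ exponential clock. When a particle's clock rings it jumps one site to the right; if that site is occupied, the occupying particle is pushed one site to the right, which in turn pushes any particle to its immediate right, and so on (i.e. the maximal block of consecutively occupied sites starting at the particle's target site is shifted one site to the right). *)

(* Defs.v *)
From HB Require Import structures.
From mathcomp Require Import all_boot all_order all_algebra.
From mathcomp Require Import all_classical all_reals all_analysis.
Set Implicit Arguments. Unset Strict Implicit. Unset Printing Implicit Defensive.
Import Order.TTheory GRing.Theory Num.Theory.
Import numFieldNormedType.Exports.
Local Open Scope classical_set_scope.
Local Open Scope ring_scope.

(* A configuration is z : nat -> bool; only sites k >= 1 are meaningful
   (site 0 is ignored).  Capacity c : option nat, None = infinity. *)

Definition below_cap (c : option nat) (g : nat) : bool :=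
  match c with Some n => (g < n)%N | None => true end.

Definition nballs (z : nat -> bool) (k : nat) : nat :=
  (\sum_(1 <= j < k.+1) z j)%N.

Definition has_d_balls (z : nat -> bool) (d : nat) : Prop :=
  exists N : nat, (forall k, (N < k)%N -> z k = false) /\ nballs z N = d.

(* carrier after processing sites 1..k : (Gamma(k), number of balls seen).
   b m is the coin eta^{(m+1)} of the (m+1)-th ball from the left. *)
Fixpoint carrier (c : option nat) (b : nat -> bool) (z : nat -> bool) (k : nat)
  : nat * nat :=
  match k with
  | 0 => (0%N, 0%N)
  | k'.+1 =>
      let: (g, m) := carrier c b z k' in
      if z k then (if b m && below_cap c g then g.+1 else g, m.+1)
      else (g.-1, m)
  end.

(* one SBBS step: zeta'(k) = 1(Gamma drops) + 1(Gamma unchanged, zeta(k)=1) *)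
Definition sbbs_step (c : option nat) (b : nat -> bool) (z : nat -> bool)
  : nat -> bool :=
  fun k => match k with
  | 0 => false
  | k'.+1 =>
      let: (g, m) := carrier c b z k' in
      if z k then ~~ (b m && below_cap c g) else (0 < g)%N
  end.

(* trajectory: eta t i is the coin of the (i+1)-th ball at time t *)
Fixpoint sbbs_traj (c : option nat) (eta : nat -> nat -> bool)
  (z0 : nat -> bool) (t : nat) : nat -> bool :=
  match t with
  | 0 => z0
  | t'.+1 => sbbs_step c (eta t') (sbbs_traj c eta z0 t')
  end.

(* position of the (i+1)-th ball from the left (0 if it does not exist) *)
Definition ball_pos (z : nat -> bool) (i : nat) : nat :=
  match pselect (exists k, (i < nballs z k)%N) with
  | left h => @ex_minn (fun k => (i < nballs z k)%N) h
  | right _ => 0%N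
  end.

Definition sbbs_scaled {R : realType} (c : option nat) (d : nat)
  (z0 : nat -> bool) (eps : R) (eta : nat -> nat -> bool)
  : R -> 'I_d -> int :=
  fun t i => (ball_pos (sbbs_traj c eta z0 (Num.truncn (t / (1 - eps)))) i)%:Z.

(* positions are x : nat -> int, x j meaningful for j < d, increasing. *)

(* particle i jumps; the maximal block of consecutive occupied sites
   starting at x i + 1 is shifted by one *)
Definition push (x : nat -> int) (i : nat) : nat -> int :=
  fun j => if (i <= j)%N && [forall k : 'I_j, (i <= k)%N ==> (x k.+1 == x k + 1)]
           then x j + 1 else x j.

(* E i k = k-th holding time of the clock of particle i; ring times *)
Definition ring_time {R : realType} (E : nat -> nat -> R) (i n : nat) : R :=
  \sum_(k < n.+1) E i k.

Definition argmin_ord {R : realType} (d : nat) (f : 'I_d -> R) : option 'I_d :=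
  [pick i | [forall j, (f i < f j) || ((f i == f j) && (i <= j)%N)]].

(* after k events: (number of rings already used per particle, positions) *)
Fixpoint ptasep_events {R : realType} (d : nat) (E : nat -> nat -> R)
  (x0 : nat -> int) (k : nat) : (nat -> nat) * (nat -> int) :=
  match k with
  | 0 => (fun _ => 0%N, x0)
  | k'.+1 =>
      let: (cnt, x) := ptasep_events d E x0 k' in
      match argmin_ord (fun i : 'I_d => ring_time E i (cnt i)) with
      | Some i => (fun j => if j == nat_of_ord i then (cnt j).+1 else cnt j,
                   push x i)
      | None => (cnt, x)
      end
  end.

(* time of the (k+1)-th event *)
Definition ptasep_evtime {R : realType} (d : nat) (E : nat -> nat -> R)
  (x0 : nat -> int) (k : nat) : R :=
  let: (cnt, _) := ptasep_events d E x0 k in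
  match argmin_ord (fun i : 'I_d => ring_time E i (cnt i)) with
  | Some i => ring_time E i (cnt i)
  | None => 0
  end.

(* PushTASEP path; on the (null) event where ring times accumulate,
   the path is set to be constant. *)
Definition pushtasep {R : realType} (d : nat) (E : nat -> nat -> R)
  (x0 : nat -> int) : R -> 'I_d -> int :=
  fun t i =>
    match pselect (forall M : R, exists k, M < ptasep_evtime d E x0 k) with
    | left _ =>
        match pselect (exists k, t < ptasep_evtime d E x0 k) with
        | left h =>
            (ptasep_events d E x0
               (@ex_minn (fun k => t < ptasep_evtime d E x0 k) h)).2 i
        | right _ => x0 i
        end
    | right _ => x0 i
    end.

Definition iid_bernoulli {R : realType} {dsp : measure_display}
  {T : measurableType dsp} (P : probability T R)
  (X : T -> nat -> nat -> bool) (p : R) : Prop :=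
  (forall t i, measurable [set w | X w t i]) /\
  forall (s : seq (nat * nat)) (v : nat * nat -> bool), uniq s ->
    P [set w | forall j, j \in s -> X w j.1 j.2 = v j]
    = ((\prod_(j <- s) (if v j then p else 1 - p))%:E)%E.

Definition exp1_cdf {R : realType} (a : R) : R :=
  if a < 0 then 0 else 1 - expR (- a).

Definition iid_exp1 {R : realType} {dsp : measure_display}
  {T : measurableType dsp} (P : probability T R)
  (X : T -> nat -> nat -> R) : Prop :=
  (forall i k (a : R), measurable [set w | X w i k <= a]) /\
  forall (s : seq (nat * nat)) (a : nat * nat -> R), uniq s ->
    P [set w | forall j, j \in s -> X w j.1 j.2 <= a j]
    = ((\prod_(j <- s) exp1_cdf (a j))%:E)%E.

Definition cadlag {R : realType} (d : nat) (x : R -> 'I_d -> int) : Prop :=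
  forall t, 0 <= t ->
    (exists2 del, 0 < del & forall s, t <= s -> s < t + del -> x s = x t) /\
    (0 < t -> exists2 del, 0 < del &
       exists v, forall s, t - del < s -> s < t -> x s = v).

Definition time_change {R : realType} (lam : R -> R) : Prop :=
  lam 0 = 0 /\
  (forall s t, 0 <= s -> s < t -> lam s < lam t) /\
  {within `[0, +oo[, continuous lam} /\
  (forall y, 0 <= y -> exists2 t, 0 <= t & lam t = y).

(* J1 convergence x_n -> x (Ethier-Kurtz, Prop. 3.5.3 (a)-(b)):
   exist lam_n in Lambda with gamma(lam_n) -> 0 and
   sup_{0<=t<=T} |x_n(t) - x(lam_n t)| -> 0 for all T. *)
Definition J1_conv {R : realType} (d : nat) (xn : nat -> R -> 'I_d -> int)
  (x : R -> 'I_d -> int) : Prop :=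
  exists lam : nat -> R -> R,
    (forall n, time_change (lam n)) /\
    (forall del : R, 0 < del -> \forall n \near \oo,
       forall s t, 0 <= t -> t < s ->
         `|ln ((lam n s - lam n t) / (s - t))| <= del) /\
    (forall T del : R, 0 < del -> \forall n \near \oo,
       forall t, 0 <= t -> t <= T -> forall i,
         (`|xn n t i - x (lam n t) i|%:~R : R) <= del).

(* bounded continuous functionals on D (J1 is metrizable, so continuity
   is sequential continuity) *)
Definition D_bounded_continuous {R : realType} (d : nat)
  (F : (R -> 'I_d -> int) -> R) : Prop :=
  (exists M : R, forall x, cadlag x -> `|F x| <= M) /\
  (forall xn x, (forall n, cadlag (xn n)) -> cadlag x -> J1_conv xn x ->
     F (xn n) @[n --> \oo] --> F x).

(* Main.v *)
Require Import Defs.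
From HB Require Import structures.
From mathcomp Require Import all_boot all_order all_algebra.
From mathcomp Require Import all_classical all_reals all_analysis.
From mathcomp Require Import measurable_realfun zify ring lra.
Import Order.TTheory GRing.Theory Num.Theory.
Import numFieldNormedType.Exports.
Local Open Scope classical_set_scope.
Local Open Scope ring_scope.
Set Implicit Arguments.
Unset Strict Implicit.
Unset Printing Implicit Defensive.

(* The proof couples the two processes on the space of the exponential clocks.
   If [E] is exponential of rate 1, then [ceil (E / (- ln e))] is geometric with
   success probability [1 - e]; hence the renewal processes with these gaps, one
   per ball, produce i.i.d. Bernoulli(1 - e) coins, and the SBBS driven by them has
   the right law.  A sweep in which the coin of exactly one ball comes up performs
   one PushTASEP jump, whatever the capacity, and a sweep without any such coin
   changes nothing.  Almost surely the ring times of distinct particles differ and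
   tend to infinity, and [1 - e] times the [m]-th success time of a coin tends to
   the [m]-th ring time; so up to any fixed time, for [e] close to 1, the SBBS makes
   the same jumps in the same order at almost the same times as PushTASEP, and a
   piecewise linear time change shows J1 convergence.  Dominated convergence
   concludes. *)

(** * One sweep of the carrier *)

(** [F] comes only with sequential continuity on cadlag paths, without measurability, and the SBBS
    lives on another probability space for each [e]. Both difficulties are met by truncating the
    coins to a finite box: there, any function of the coins is a finite combination of indicators,
    hence measurable, and its mean depends only on the success probability; and [F] of the truncated
    path tends to [F] of the path, because a finite time horizon reads finitely many coins. So the
    mean for the SBBS may be computed on the space of the clocks. The scale [- ln e] is dictated by
    [P (E > r * (- ln e)) = e ^ r], and the rescaled success times approach the ring times because
    [(1 - e) / (- ln e)] tends to 1. The coins also serve to exclude ties, so that no densities or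
    convolutions are needed. *)

Lemma nballsS z k : nballs z k.+1 = (nballs z k + z k.+1)%N.
Proof. by rewrite /nballs big_nat_recr. Qed.

Lemma nballs0 z : nballs z 0 = 0%N.
Proof. by rewrite /nballs big_geq. Qed.

Lemma leq_nballs z : {homo nballs z : k l / (k <= l)%N}.
Proof. by apply: homo_leq => // [|k]; [exact: leq_trans|rewrite nballsS leq_addr]. Qed.

Lemma carrier2E c b z k : (carrier c b z k).2 = nballs z k.
Proof.
elim: k => [|k IH]; first by rewrite nballs0.
rewrite nballsS /= -IH; case: carrier => g m /=.
by case: ifP => _ /=; rewrite ?addn1 ?addn0.
Qed.

Lemma nballs_sbbs_step c b z k :
  (nballs (sbbs_step c b z) k + (carrier c b z k).1 = nballs z k)%N.
Proof.
elim: k => [|k IH]; first by rewrite !nballs0.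
rewrite !nballsS -IH /=; case: carrier => g m /=.
case: ifP => _; first by case: ifP => _ /=; lia.
by case: g => [|g] /=; lia.
Qed.

Lemma nballs_sbbs_traj c eta z n k : (nballs (sbbs_traj c eta z n) k <= nballs z k)%N.
Proof.
elim: n => [//|n IH] /=; apply: leq_trans IH.
by rewrite -[leqRHS](nballs_sbbs_step c (eta n)) leq_addr.
Qed.

(** A coin is read only at an occupied site, and its index is then the number of balls before that
    site, which is below [d]. This reduces a path on a finite time horizon to finitely many
    coins. *)
Lemma eq_sbbs_step c b b' z d : (forall k, nballs z k <= d)%N ->
  (forall i, (i < d)%N -> b i = b' i) -> sbbs_step c b z = sbbs_step c b' z.
Proof.
move=> zd bb'.
have bE k : z k.+1 -> b (nballs z k) = b' (nballs z k).
  by move=> zk; apply: bb'; have := zd k.+1; rewrite nballsS zk addn1.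
have cE k : carrier c b z k = carrier c b' z k.
  elim: k => [//|k IH] /=; rewrite -IH.
  case: carrier (carrier2E c b z k) => g m /= ->.
  by case: ifP => // /bE ->.
apply/funext => -[//|k] /=; rewrite -cE.
case: carrier (carrier2E c b z k) => g m /= ->.
by case: ifP => // /bE ->.
Qed.

Lemma eq_sbbs_traj c eta eta' z d n : (forall k, nballs z k <= d)%N ->
  (forall t i, (t < n)%N -> (i < d)%N -> eta t i = eta' t i) ->
  sbbs_traj c eta z n = sbbs_traj c eta' z n.
Proof.
move=> zd; elim: n => [//|n IH] ee' /=.
rewrite -IH => [|t i tn id]; last by rewrite ee' // ltnS ltnW.
apply: (@eq_sbbs_step _ _ _ _ d) => [k|i id]; last exact: ee'.
exact: leq_trans (nballs_sbbs_traj _ _ _ _ _) (zd k).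
Qed.

(** Site 0 is left out of the last clause because [z 0] is arbitrary in the initial
    configuration. *)
Definition ball_positions (d : nat) (z : nat -> bool) (p : nat -> nat) : Prop :=
  [/\ forall j, (j < d)%N -> (0 < p j)%N,
      forall j, (j.+1 < d)%N -> (p j < p j.+1)%N &
      forall k, (0 < k)%N -> z k = [exists j : 'I_d, p j == k]].

Section Positions.
Context (d : nat) (z : nat -> bool) (p : nat -> nat).
Hypothesis zp : ball_positions d z p.

Lemma ball_positions_lt i j : (i < j)%N -> (j < d)%N -> (p i < p j)%N.
Proof.
case: zp => _ pS _; elim: j => // j IH; rewrite ltnS leq_eqVlt => /orP[/eqP->|ij] jd.
  exact: pS.
by apply: ltn_trans (pS _ jd); apply: IH => //; exact: ltnW.
Qed.

Lemma ball_positions_le i j : (i <= j)%N -> (j < d)%N -> (p i <= p j)%N.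
Proof.
by rewrite leq_eqVlt => /orP[/eqP->//|ij jd]; apply/ltnW/ball_positions_lt.
Qed.

Lemma ball_positions_inj i j : (i < d)%N -> (j < d)%N -> p i = p j -> i = j.
Proof.
move=> id jd pij; case: (ltngtP i j) => // ij.
  by have := ball_positions_lt ij jd; rewrite pij ltnn.
by have := ball_positions_lt ij id; rewrite pij ltnn.
Qed.

Lemma ball_positionsP k : (0 < k)%N ->
  reflect (exists2 j, (j < d)%N & p j = k) (z k).
Proof.
move=> k0; case: zp => _ _ ->//; apply: (iffP existsP) => [[j /eqP <-]|[j jd <-]].
  by exists j.
by exists (Ordinal jd) => /=.
Qed.

Lemma ball_positions_mem j : (j < d)%N -> z (p j).
Proof. by move=> jd; apply/ball_positionsP; [case: zp => /(_ _ jd)|exists j]. Qed.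

Lemma nballs_positions k : nballs z k = (\sum_(j < d) (p j <= k))%N.
Proof.
case: (zp) => p0 pS zE; elim: k => [|k IH].
  rewrite nballs0 big1 // => j _.
  by have := p0 j (ltn_ord j); rewrite leqn0; case: (p j).
rewrite nballsS IH.
transitivity (\sum_(j < d) ((p j <= k) + (p j == k.+1)))%N; last first.
  by apply: eq_bigr => j _; rewrite [in RHS]leq_eqVlt ltnS; case: ltngtP => //; lia.
rewrite big_split /=; congr addn.
rewrite zE //; case: existsP => [[j /eqP pj]|N].
  rewrite (bigD1 j) //= pj eqxx big1 // => l /negPf lj.
  apply/eqP; rewrite eqb0; apply: contraFN lj => /eqP pl; apply/eqP/val_inj => /=.
  by apply: ball_positions_inj => //; rewrite pl pj.
rewrite big1 // => j _; apply/eqP; rewrite eqb0; apply/negP => pj.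
by apply: N; exists j.
Qed.

(** When the carrier reaches ball [j] it has seen [j] balls, so the coin it reads is the one of
    index [j]. *)
Lemma nballs_position j : (j < d)%N -> nballs z (p j).-1 = j.
Proof.
move=> jd; rewrite nballs_positions.
transitivity (\sum_(i < d) (i < j))%N.
  apply: eq_bigr => i _; congr nat_of_bool.
  have pj : (0 < p j)%N by case: zp => /(_ _ jd).
  case: (ltnP i j) => [ij|ji].
    by have := ball_positions_lt ij jd; lia.
  by have := ball_positions_le ji (ltn_ord i); lia.
rewrite -(big_mkord xpredT (fun i => nat_of_bool (i < j)%N)).
rewrite (big_cat_nat (n := j)) //= ?(ltnW jd) //.
rewrite [X in (_ + X)%N]big_nat_cond [X in (_ + X)%N]big1 => [|i]; last first.
  by rewrite andbT => /andP[ji _]; rewrite ltnNge ji.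
rewrite addn0 big_nat_cond (eq_bigr (fun=> 1%N)) => [|i]; last first.
  by rewrite andbT => /andP[_ ->].
by rewrite -big_nat_cond sum_nat_const_nat subn0 muln1.
Qed.

Lemma nballs_le_positions k : (nballs z k <= d)%N.
Proof.
rewrite nballs_positions; apply: (@leq_trans (\sum_(j < d) 1)%N).
  by apply: leq_sum => j _; exact: leq_b1.
by rewrite sum_nat_const card_ord muln1.
Qed.

Lemma ball_posE j : (j < d)%N -> ball_pos z j = p j.
Proof.
move=> jd; have pj : (0 < p j)%N by case: zp => /(_ _ jd).
have zj : nballs z (p j) = j.+1.
  by rewrite -[X in nballs _ X](prednK pj) nballsS nballs_position // prednK //
     ball_positions_mem // addn1.
rewrite /ball_pos; case: pselect => [h|[]]; last by exists (p j); rewrite zj.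
case: ex_minnP => k jk kmin; apply/eqP; rewrite eqn_leq kmin ?zj //=.
rewrite leqNgt; apply/negP => kp.
have := @leq_nballs z k (p j).-1; rewrite nballs_position //; lia.
Qed.

Let run s k := (s <= k)%N && [forall l : 'I_k.+1, (s <= l)%N ==> z l].

Let runP s k : reflect ((s <= k)%N /\ forall l, (s <= l <= k)%N -> z l) (run s k).
Proof.
apply: (iffP andP) => -[sk h]; split=> //.
  move=> l /andP[sl lk]; move/forallP: h => /(_ (Ordinal (lk : (l < k.+1)%N))) /=.
  by rewrite sl.
by apply/forallP => l; apply/implyP => sl; apply: h; rewrite sl -ltnS ltn_ord.
Qed.

Let runS s k : run s k.+1 = z k.+1 && ((k.+1 == s) || run s k).
Proof.
apply/runP/andP => [[sk h]|[zk]].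
  split; first by apply: h; rewrite sk leqnn.
  case: eqP => //= /eqP ks; have {}sk : (s <= k)%N by lia.
  by apply/runP; split => // l /andP[sl lk]; apply: h; lia.
case/orP => [/eqP ks|/runP[sk h]].
  by rewrite -ks; split=> // l ?; have -> : l = k.+1 by lia.
split; first exact: leqW.
by move=> l; case: (ltngtP l k.+1) => [lk sl|lk|->//]; [apply: h|]; lia.
Qed.

(** Ball [i] is picked up by an empty carrier and set down at the first empty site after [p i]; no
    other ball is picked up. The load never exceeds 1, so the capacity enters only through
    [below_cap c 0]. *)
Lemma carrier_single c b i k : below_cap c 0 -> (i < d)%N ->
  (forall j, (j < d)%N -> b j = (j == i)) ->
  carrier c b z k = (nat_of_bool (run (p i) k), nballs z k).
Proof.
move=> c0 id bE; elim: k => [|k IH].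
  rewrite nballs0 /=; case: (runP (p i) 0) => //= -[].
  by case: zp => /(_ _ id); lia.
rewrite /= IH runS nballsS; case: ifP => zk /=; rewrite ?addn1 ?addn0; last first.
  by case: run.
have [j jd pj] := ball_positionsP (ltn0Sn k) zk.
have -> : nballs z k = j by rewrite -(nballs_position jd) pj.
rewrite bE //; case: (eqVneq j i) => [ji|ji] /=.
  rewrite -pj ji eqxx /=.
  suff -> : run (p i) k = false by rewrite c0.
  by apply/negP => /runP[+ _]; rewrite -ji pj ltnn.
suff -> : (k.+1 == p i) = false by [].
by apply: contra_neqF ji => /eqP pi; apply: ball_positions_inj => //; rewrite pj pi.
Qed.

Lemma sbbs_step_singleE c b i k : below_cap c 0 -> (i < d)%N ->
  (forall j, (j < d)%N -> b j = (j == i)) ->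
  sbbs_step c b z k.+1 = if z k.+1 then k.+1 != p i else run (p i) k.
Proof.
move=> c0 id bE; rewrite /= (carrier_single k c0 id bE).
case: ifP => [zk|_]; last by case: run.
have [j jd pj] := ball_positionsP (ltn0Sn k) zk.
have -> : nballs z k = j by rewrite -(nballs_position jd) pj.
rewrite bE // -pj; case: (eqVneq j i) => [ji|ji] /=.
  rewrite -ji eqxx; suff -> : run (p j) k = false by rewrite c0.
  by apply/negP => /runP[+ _]; rewrite pj ltnn.
by apply/esym; apply: contraNneq ji => pi; apply/eqP/ball_positions_inj.
Qed.

(** [push] finds its block through consecutive indices, the carrier through consecutive occupied
    sites; the two agree because no occupied site lies between successive balls. *)
Let push_runE i j (x : nat -> int) : (i < d)%N -> (j < d)%N ->
  (forall l, (l < d)%N -> x l = (p l)%:Z) ->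
  push x i j = (p j + run (p i) (p j))%N%:Z.
Proof.
move=> id jd xE; rewrite /push.
suff -> : (i <= j)%N && [forall k : 'I_j, (i <= k)%N ==> (x k.+1 == x k + 1)]
    = run (p i) (p j).
  by rewrite xE //; case: run; lia.
apply/andP/runP => [[ij /forallP h]|[pij h]].
  have {}h k : (i <= k < j)%N -> p k.+1 = (p k).+1.
    move=> /andP[ik kj]; have := h (Ordinal kj); rewrite /= ik !xE //; lia.
  split; first exact: ball_positions_le.
  move=> l lij; suff [k kij <-] : exists2 k, (i <= k <= j)%N & p k = l.
    by apply: ball_positions_mem; lia.
  elim: l lij => [|l IH] lij.
    by exists i; [lia|have : (0 < p i)%N by case: zp => /(_ _ id)]; lia.
  have [lpi|lpi] := eqVneq (p i) l.+1; first by exists i => //; lia.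
  have [|k kij pk] := IH; first lia.
  have kj : k != j by apply: contraTneq lij => kj; rewrite -pk kj; lia.
  by exists k.+1; [lia|rewrite h ?pk //; lia].
split.
  by rewrite leqNgt; apply/negP => ji; have := ball_positions_lt ji id; lia.
apply/forallP => k; apply/implyP => ik.
have kj := ltn_ord k; have kd := ltn_trans kj jd.
have pk := ball_positions_lt (ltnSn k) (leq_ltn_trans kj jd).
have pkj := ball_positions_le kj jd.
have pik := ball_positions_le ik kd.
have /ball_positionsP[//|l ld pl] : z (p k).+1 by apply: h; lia.
have kl : (k < l)%N.
  by rewrite ltnNge; apply/negP => lk; have := ball_positions_le lk kd; lia.
have := ball_positions_le kl ld.
by rewrite !xE //; lia.
Qed.

(** The picked ball leaps over its block to the first empty site. Since balls are labelled from left
    to right, the result is the same as moving every ball of the block by one, which is the push. *)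
Lemma sbbs_step_single c b i (x : nat -> int) : below_cap c 0 -> (i < d)%N ->
  (forall j, (j < d)%N -> b j = (j == i)) ->
  (forall j, (j < d)%N -> x j = (p j)%:Z) ->
  exists2 p', ball_positions d (sbbs_step c b z) p' &
    forall j, (j < d)%N -> push x i j = (p' j)%:Z.
Proof.
move=> c0 id bE xE; exists (fun j => p j + run (p i) (p j))%N; last first.
  by move=> j jd; exact: push_runE.
have run0 k : run (p i) k -> (0 < k)%N.
  by case/runP => + _; case: zp => /(_ _ id); lia.
have runz k : run (p i) k -> z k by case/runP => ? h; apply: h; lia.
have zi := ball_positions_mem id.
have runi : run (p i) (p i).
  by apply/runP; split => // l ?; have -> : l = p i by lia.
split.
- by move=> j jd; case: zp => /(_ _ jd); lia.
- move=> j jd; have := ball_positions_lt (ltnSn j) jd.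
  have := ball_positions_mem jd.
  have [<- zj|] := eqVneq (p j).+1 (p j.+1); last by lia.
  by rewrite runS zj; case: (run _ (p j)); rewrite ?orbT; lia.
- case=> // k _; rewrite (sbbs_step_singleE k c0 id bE).
  apply/idP/existsP => [|[[j jd] /= /eqP jk]].
    case: ifP => [zk ki|zk rk].
      have [j jd pj] := ball_positionsP (ltn0Sn k) zk.
      case: (boolP (run (p i) k.+1)) => [|/negPf rk]; last first.
        by exists (Ordinal jd) => /=; rewrite pj rk addn0.
      rewrite runS zk (negPf ki) /= => rk.
      have [l ld pl] := ball_positionsP (run0 _ rk) (runz _ rk).
      by exists (Ordinal ld) => /=; rewrite pl rk addn1.
    have [l ld pl] := ball_positionsP (run0 _ rk) (runz _ rk).
    by exists (Ordinal ld) => /=; rewrite pl rk addn1.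
  move: jk; case: (boolP (run (p i) (p j))) => [r|/negPf r] /=.
    rewrite addn1 => -[jk]; rewrite jk in r; rewrite r.
    case: ifP => // _; case/runP: r => + _; lia.
  rewrite addn0 => jk; rewrite -jk ball_positions_mem //.
  by apply: contraFneq r => ->.
Qed.

Lemma sbbs_step_none c b : (forall j, (j < d)%N -> b j = false) ->
  ball_positions d (sbbs_step c b z) p.
Proof.
move=> bE.
have bz k : z k.+1 -> b (nballs z k) = false.
  move=> /(ball_positionsP (ltn0Sn k))[j jd pj].
  by rewrite (_ : nballs z k = j) ?bE // -(nballs_position jd) pj.
have cE k : (carrier c b z k).1 = 0%N.
  elim: k => //= k; case: carrier (carrier2E c b z k) => g m /= -> ->.
  by case: ifP => // /bz ->.
case: (zp) => p0 pS zE; split => // -[//|k] _; rewrite -zE //=.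
have := cE k; case: carrier (carrier2E c b z k) => g m /= -> ->.
by case: ifP => [/bz ->|].
Qed.

End Positions.

Lemma has_d_balls_positions z d : has_d_balls z d -> ball_positions d z (ball_pos z).
Proof.
move=> [N [zN dN]].
have nle k : (nballs z k <= d)%N.
  case: (leqP k N) => kN; first by rewrite -dN leq_nballs.
  rewrite -dN -(subnKC (ltnW kN)); elim: (k - N)%N => [|l]; first by rewrite addn0.
  by rewrite addnS nballsS zN ?addn0 // ltnS leq_addr.
have bpP j : (j < d)%N -> [/\ (j < nballs z (ball_pos z j))%N &
    forall k, (j < nballs z k)%N -> (ball_pos z j <= k)%N].
  move=> jd; rewrite /ball_pos; case: pselect => [h|[]]; last by exists N; rewrite dN.
  by case: ex_minnP.
split.
- by move=> j /bpP[+ _]; case: (ball_pos z j) => //; rewrite nballs0.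
- move=> j jd; have [jn jmin] := bpP _ (ltnW jd); have [Sjn _] := bpP _ jd.
  have le := jmin _ (ltnW Sjn).
  rewrite ltn_neqAle le andbT; apply/eqP => e; rewrite -e in Sjn.
  move: Sjn jmin; case: (ball_pos z j) => [|k]; first by rewrite nballs0.
  rewrite nballsS => jk /(_ k) h.
  have /h : (j < nballs z k)%N by move: jk; case: (z k.+1); lia.
  by rewrite ltnn.
- case=> // k _; apply/idP/existsP => [zk|[[j jd] /= /eqP jk]].
    have kd : (nballs z k < d)%N by have := nle k.+1; rewrite nballsS zk addn1.
    exists (Ordinal kd) => /=; have [jn jmin] := bpP _ kd.
    rewrite eqn_leq jmin /=; last by rewrite nballsS zk addn1.
    by rewrite ltnNge; apply/negP => /(@leq_nballs z); rewrite leqNgt jn.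
  have [] := bpP _ jd; rewrite jk nballsS => jn /(_ k); rewrite ltnn.
  by case: (z k.+1) jn => //; rewrite addn0 => -> /(_ isT).
Qed.

(** * Piecewise linear time changes *)

Section TimeChange.
Context {R : realType}.

(** Each pair holds the length of an interval and the length of its image, the intervals following
    one another from 0; after the list the slope is 1, whence the conditions [A <= 1] and [1 <= B]
    below. *)
Fixpoint pl_map (l : seq (R * R)) (t : R) : R :=
  match l with
  | [::] => t
  | (a, b) :: l' => if t <= a then b / a * t else b + pl_map l' (t - a)
  end.

Definition slopes_in (A B : R) (l : seq (R * R)) :=
  all (fun ab => [&& 0 < ab.1, A * ab.1 <= ab.2 & ab.2 <= B * ab.1]) l.

Lemma pl_map0 A B l : slopes_in A B l -> pl_map l 0 = 0.
Proof. by case: l => [//|[a b] l] /= /andP[/andP[/ltW -> _] _]; rewrite mulr0. Qed.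

Lemma pl_map_incr A B l s t : A <= 1 -> 1 <= B -> slopes_in A B l -> s < t ->
  A * (t - s) <= pl_map l t - pl_map l s <= B * (t - s).
Proof.
move=> A1 B1; elim: l s t => [|[a b] l IH] s t /=.
  by move=> _ st; rewrite !ler_piMl ?ler_peMl ?subr_ge0 // ltW.
move=> /andP[/and3P[a0 Aab abB] sl] st.
have sE : b = b / a * a by rewrite divfK // gt_eqF.
have Ab : A <= b / a by rewrite ler_pdivlMr.
have bB : b / a <= B by rewrite ler_pdivrMr.
case: (leP t a) => ta.
  rewrite (le_trans (ltW st) ta) -mulrBr.
  by apply/andP; split; apply: ler_wpM2r => //; rewrite subr_ge0 ltW.
have ta0 : 0 < t - a by rewrite subr_gt0.
case: (leP s a) => sa; last first.
  have := IH (s - a) (t - a) sl; rewrite ltrD2r => /(_ st).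
  have -> : t - a - (s - a) = t - s by ring.
  by have -> : b + pl_map l (t - a) - (b + pl_map l (s - a)) =
             pl_map l (t - a) - pl_map l (s - a) by ring.
have := IH 0 (t - a) sl ta0; rewrite (pl_map0 sl) !subr0 => /andP[h1 h2].
have -> : b + pl_map l (t - a) - b / a * s = b / a * (a - s) + pl_map l (t - a).
  by rewrite mulrBr -sE; ring.
have -> : t - s = (a - s) + (t - a) by ring.
rewrite [A * _]mulrDr [B * _]mulrDr; apply/andP; split; apply: lerD => //.
  by apply: ler_wpM2r => //; rewrite subr_ge0.
by apply: ler_wpM2r => //; rewrite subr_ge0.
Qed.

Lemma pl_map_surj A B l y : 0 < A -> slopes_in A B l -> 0 <= y ->
  exists2 t, 0 <= t & pl_map l t = y.
Proof.
move=> A0; elim: l y => [|[a b] l IH] y /=; first by exists y.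
move=> /andP[/and3P[a0 Aab abB] sl] y0.
have b0 : 0 < b by apply: lt_le_trans Aab; rewrite mulr_gt0.
have [yb|yb] := leP y b.
  exists (a / b * y); first by rewrite mulr_ge0 // divr_ge0 // ltW.
  rewrite ifT.
    by field; rewrite !gt_eqF.
  by rewrite mulrAC ler_pdivrMr // ler_pM2l.
have [|t t0 tE] := IH (y - b) sl; first by rewrite subr_ge0 ltW.
move: t0; rewrite le_eqVlt => /orP[/eqP t0|t0].
  by move: tE yb; rewrite -t0 (pl_map0 sl) -subr_gt0 => <-; rewrite ltxx.
exists (t + a); first by rewrite addr_ge0 // ltW.
by rewrite leNgt ltrDr t0 /= addrK tE addrC subrK.
Qed.

Lemma pl_map_sum (l1 l2 : seq (R * R)) A B : slopes_in A B l1 ->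
  slopes_in A B l2 ->
  pl_map (l1 ++ l2) (\sum_(ab <- l1) ab.1) = \sum_(ab <- l1) ab.2.
Proof.
move=> sl1 sl2; elim: l1 sl1 => [|[a b] l1 IH] /=.
  by rewrite !big_nil (pl_map0 sl2).
move=> /andP[/and3P[a0 Aab abB] sl1]; rewrite !big_cons /=.
have s0 : 0 <= \sum_(ab <- l1) ab.1.
  rewrite big_seq sumr_ge0 // => ab abl.
  by have /and3P[/ltW] := allP sl1 _ abl.
have [h|h] := leP; last by rewrite addrAC subrr add0r IH.
have e : \sum_(ab <- l1) ab.1 = 0 by apply: le_anti; rewrite s0 andbT; lra.
rewrite -IH // e addr0 divfK ?gt_eqF // (@pl_map0 A B) ?addr0 //.
by rewrite /slopes_in all_cat; apply/andP.
Qed.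

Lemma pl_map_continuous A B l : A <= 1 -> 1 <= B -> 0 < A -> slopes_in A B l ->
  continuous (pl_map l).
Proof.
move=> A1 B1 A0 sl t; apply/cvgrPdist_le => e e0.
have B0 : 0 < B by apply: lt_le_trans B1.
have eB : 0 < e / B by rewrite divr_gt0.
near=> s.
have ts : `|t - s| <= e / B.
  by near: s; apply: cvgr_dist_le => //; exact: cvg_id.
suff : `|pl_map l t - pl_map l s| <= B * `|t - s|.
  by move=> /le_trans; apply; rewrite -ler_pdivlMl // mulrC.
have lip u v : u < v -> `|pl_map l v - pl_map l u| <= B * `|v - u|.
  move=> uv; have /andP[h1 h2] := pl_map_incr A1 B1 sl uv.
  have uv0 : 0 <= v - u by rewrite subr_ge0 ltW.
  by rewrite !ger0_norm // (le_trans _ h1) // mulr_ge0 // ltW.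
case: (ltgtP s t) => [st|st|->]; last by rewrite !subrr normr0 mulr0.
  exact: lip.
by rewrite distrC [`|t - s|]distrC; exact: lip.
Unshelve. all: by end_near. Qed.

Lemma pl_map_time_change A B l : A <= 1 -> 1 <= B -> 0 < A -> slopes_in A B l ->
  time_change (pl_map l).
Proof.
move=> A1 B1 A0 sl; split; first exact: pl_map0 sl.
split; last split.
- move=> s t _ st; have /andP[h _] := pl_map_incr A1 B1 sl st.
  by rewrite -subr_gt0 (lt_le_trans _ h) // mulr_gt0 // subr_gt0.
- by apply: continuous_subspaceT; exact: pl_map_continuous sl.
- by move=> y; exact: pl_map_surj sl.
Qed.

Lemma pl_map_ln_slope del l s t : 0 <= del ->
  slopes_in (expR (- del)) (expR del) l -> t < s ->
  `|ln ((pl_map l s - pl_map l t) / (s - t))| <= del.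
Proof.
move=> d0 sl ts.
have e1 : expR (- del) <= 1 by rewrite -expR0 ler_expR oppr_le0.
have e2 : 1 <= expR del by rewrite -[leLHS]expR0 ler_expR.
have /andP[h1 h2] := pl_map_incr e1 e2 sl ts.
have st0 : 0 < s - t by rewrite subr_gt0.
have q1 : expR (- del) <= (pl_map l s - pl_map l t) / (s - t) by rewrite ler_pdivlMr.
have q2 : (pl_map l s - pl_map l t) / (s - t) <= expR del by rewrite ler_pdivrMr.
have q0 := lt_le_trans (expR_gt0 _) q1.
rewrite ler_norml; apply/andP; split.
  by rewrite -[leLHS]expRK ler_ln ?posrE ?expR_gt0.
by rewrite -[leRHS]expRK ler_ln ?posrE ?expR_gt0.
Qed.

End TimeChange.

(* Diagonal extraction: [lam n] is chosen for the largest [K <= n] for which a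
   suitable time change exists. *)
Lemma J1_convI (R : realType) (d : nat) (xn : nat -> R -> 'I_d -> int)
    (x : R -> 'I_d -> int) :
  (forall K : nat, \forall n \near \oo, exists lam : R -> R, [/\ time_change lam,
    forall s t, 0 <= t -> t < s -> `|ln ((lam s - lam t) / (s - t))| <= K.+1%:R^-1 &
    forall t, 0 <= t -> t <= K%:R -> xn n t = x (lam t)]) ->
  J1_conv xn x.
Proof.
move=> h.
pose good K n lam := [/\ time_change lam,
    forall s t, 0 <= t -> t < s -> `|ln ((lam s - lam t) / (s - t))| <= K.+1%:R^-1 :> R &
    forall t, 0 <= t -> t <= K%:R -> xn n t = x (lam t)].
(* Goodness passes to smaller [K], so the choice made for the largest admissible [K] serves all of
   them at once; the identity is the default when there is none. *)
have goodS K K' n lam : (K <= K')%N -> good K' n lam -> good K n lam.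
  move=> KK' [tl sl pl]; split=> // [s t t0 ts|t t0 tK].
    by rewrite (le_trans (sl _ _ t0 ts)) // lef_pV2 ?posrE ?ltr0n // ler_nat.
  by apply: pl => //; rewrite (le_trans tK) // ler_nat.
have tcid : time_change (@id R).
  split=> //; split=> //; split; last by move=> y y0; exists y.
  by apply: continuous_subspaceT => t; exact: cvg_id.
have lamE n : exists lam, time_change lam /\ forall K, (K <= n)%N ->
    (exists l, good K n l) -> good K n lam.
  have [[K0 [K0n K0g]]|N] := pselect (exists K, (K <= n)%N /\ exists l, good K n l).
    pose p K := (K <= n)%N && `[< exists l, good K n l >].
    have exp : exists K, p K by exists K0; rewrite /p K0n; apply/asboolP.
    have pn K : p K -> (K <= n)%N by case/andP.
    case: (ex_maxnP exp pn) => K /andP[Kn /asboolP[l lg]] Kmax.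
    exists l; split; first by case: lg.
    move=> K' K'n K'g; apply: goodS lg.
    by apply: Kmax; rewrite /p K'n; apply/asboolP.
  by exists id; split=> // K Kn Kg; case: N; exists K.
have {lamE} [lam lamP] := choice lamE.
have good_near K : \forall n \near \oo, good K n (lam n).
  near=> n; apply: (lamP n).2; first by near: n; exact: nbhs_infty_ge.
  by near: n; exact: h.
exists lam; split; first by move=> n; exact: (lamP n).1.
split=> [del del0|T del del0].
  have [K Kdel] : exists K : nat, K.+1%:R^-1 <= del.
    have [K /ltW] := ltr_add_invr del0; rewrite add0r; by exists K.
  near=> n => s t t0 ts.
  have [_ sl _] : good K n (lam n) by near: n; exact: good_near.
  exact: le_trans (sl _ _ t0 ts) Kdel.
near=> n => t t0 tT i.
have [_ _ pl] : good (Num.truncn T).+1 n (lam n) by near: n; exact: good_near.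
rewrite pl //; first by rewrite subrr normr0 ltW.
by rewrite (le_trans tT) // ltW // truncnS_gt.
Unshelve. all: by end_near. Qed.

(** * Renewal coins and the coupling *)

Section RenewalCoins.
Context {R : realType}.
Implicit Types (lam : R) (x : nat -> R).

(* [(m, r)]: [m] clocks have rung, the last one [r] steps ago *)
Fixpoint renewal_state lam x (n : nat) : nat * nat :=
  match n with
  | 0 => (0%N, 0%N)
  | n'.+1 => let: (m, r) := renewal_state lam x n' in
             if x m <= r.+1%:R * lam then (m.+1, 0%N) else (m, r.+1)
  end.

Definition renewal_coin lam x (n : nat) : bool :=
  let: (m, r) := renewal_state lam x n in x m <= r.+1%:R * lam.

Definition renewal_coins lam (E : nat -> nat -> R) (t i : nat) : bool :=
  renewal_coin lam (E i) t.

Definition gap lam (y : R) : nat := `|Num.ceil (y / lam)|%N.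

Definition firing lam x (m : nat) : nat := \sum_(k < m) gap lam (x k).

Lemma gapE lam y : 0 < lam -> 0 < y -> (gap lam y)%:Z = Num.ceil (y / lam).
Proof. by move=> l0 y0; rewrite /gap gez0_abs // ltW // ceil_gt0 divr_gt0. Qed.

Lemma gap_le lam y r : 0 < lam -> 0 < y -> (gap lam y <= r)%N = (y <= r%:R * lam).
Proof.
by move=> l0 y0; rewrite -lez_nat gapE // real_ceil_le_int ?num_real // ler_pdivrMr.
Qed.

Lemma gap_gt0 lam y : 0 < lam -> 0 < y -> (0 < gap lam y)%N.
Proof. by move=> l0 y0; rewrite ltnNge gap_le // mul0r -ltNge. Qed.

Lemma firingS lam x m : firing lam x m.+1 = (firing lam x m + gap lam (x m))%N.
Proof. by rewrite /firing big_ord_recr. Qed.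

Section Positive.
Context lam x (lam_gt0 : 0 < lam) (x_gt0 : forall k, 0 < x k).

Lemma firing_lt : {homo firing lam x : m n / (m < n)%N}.
Proof.
apply: homo_ltn => [? ? ?|m]; first exact: ltn_trans.
by rewrite firingS -[ltnLHS]addn0 ltn_add2l gap_gt0.
Qed.

Lemma firing_le : {homo firing lam x : m n / (m <= n)%N}.
Proof. by apply: homo_leq => // [|m]; [exact: leq_trans|rewrite firingS leq_addr]. Qed.

Lemma renewal_stateP n : let: (m, r) := renewal_state lam x n in
  (r + firing lam x m)%N = n /\ (r < gap lam (x m))%N.
Proof.
elim: n => [|n] /=; first by rewrite /firing big_ord0 gap_gt0.
case: renewal_state => m r [rm rg]; case: ifP => xm.
  split; last exact: gap_gt0.
  have : (gap lam (x m) <= r.+1)%N by rewrite gap_le.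
  by rewrite firingS; lia.
split; first lia.
by rewrite ltnNge gap_le // xm.
Qed.

(** The coins of index [n] drive the sweep from time [n] to time [n + 1], hence the shift: [firing]
    counts the sweeps completed once a success has taken effect. *)
Lemma renewal_coinP n :
  reflect (exists m, firing lam x m.+1 = n.+1) (renewal_coin lam x n).
Proof.
rewrite /renewal_coin; have := renewal_stateP n.
case: renewal_state => m r [rm rg]; rewrite -gap_le //.
apply: (iffP idP) => [h|[m' h]]; first by exists m; rewrite firingS; lia.
case: (ltngtP m m') => [mm'|mm'|mm'].
- have := firing_lt (mm' : (m.+1 < m'.+1)%N); rewrite h firingS; lia.
- have := firing_le mm'; rewrite h; lia.
- by move: h; rewrite -mm' firingS; lia.
Qed.

End Positive.

(** With [lam = - ln e], this combines [1 - e <= lam <= (1 - e) / e] with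
    [y <= gap lam y * lam <= y + lam]. *)
Lemma gap_bounds (e y : R) : 0 < e < 1 -> 0 < y ->
  y - (1 - e) * y <= (1 - e) * (gap (- ln e) y)%:R <= y + (1 - e).
Proof.
move=> /andP[e0 e1] y0; set lam := - ln e.
have lam0 : 0 < lam by rewrite oppr_gt0 ln_lt0 // e0.
have lam1 : 1 - e <= lam.
  rewrite /lam lerNr opprB; have := @le_ln1Dx R (e - 1).
  by rewrite subrKC; apply; lra.
have lam2 : e * lam <= 1 - e.
  have := @le_ln1Dx R (e^-1 - 1); rewrite subrKC lnV ?posrE //.
  have ei : 0 < e^-1 by rewrite invr_gt0.
  have /[swap]/[apply] : -1 < e^-1 - 1 by lra.
  rewrite -(ler_pM2l e0) mulrBr mulr1 mulfV ?gt_eqF //.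
have g1 : y <= (gap lam y)%:R * lam by rewrite -gap_le.
have g2 : (gap lam y)%:R * lam <= y + lam.
  rewrite -lerBlDr; have := gap_gt0 lam0 y0.
  case: (gap lam y) (@gap_le lam y) => // n /(_ n lam0 y0); rewrite ltnn => /esym/negbT.
  by rewrite -ltNge => /ltW h _; rewrite -natr1; lra.
set g := (gap lam y)%:R in g1 g2 *.
have g0 : 0 <= g by rewrite /g.
apply/andP; split.
  apply: (@le_trans _ _ (e * (g * lam))); last by rewrite mulrCA mulrC ler_wpM2r.
  by rewrite -{1}[y]mul1r -mulrBl opprB addrCA subrr addr0 ler_wpM2l // ltW.
have -> : (1 - e) * g = (1 - e) / lam * (g * lam) by field; rewrite gt_eqF.
have q1 : (1 - e) / lam <= 1 by rewrite ler_pdivrMr // mul1r.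
have q0 : 0 <= (1 - e) / lam by rewrite divr_ge0 ?ltW // subr_gt0.
apply: (le_trans (ler_wpM2l q0 g2)); rewrite mulrDr divfK ?gt_eqF // lerD2r.
by rewrite ler_piMl // ltW.
Qed.

(** Sums [gap_bounds] over the gaps. The error depends on the clocks only through the ring time, a
    uniformity that the estimate for ties requires besides the limit [firing_cvg]. *)
Lemma firing_bound (e : R) x m : 0 < e < 1 -> (forall k, 0 < x k) ->
  `|(1 - e) * (firing (- ln e) x m)%:R - \sum_(k < m) x k| <=
    (1 - e) * (\sum_(k < m) x k + m%:R).
Proof.
move=> e01 x0; elim: m => [|m IH].
  by rewrite /firing !big_ord0 mulr0 subrr normr0 addr0 mulr0.
rewrite firingS natrD mulrDr !big_ord_recr /= opprD addrACA (le_trans (ler_normD _ _)) //.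
rewrite -natr1 addrACA mulrDr lerD //.
have /andP[e0 e1] := e01; have := gap_bounds e01 (x0 m); have := x0 m.
set g := gap _ _; move=> xm /andP[h1 h2].
have : 0 <= (1 - e) * x m by rewrite mulr_ge0 ?subr_ge0 ?ltW.
by rewrite ler_norml mulrDr mulr1 => ?; apply/andP; split; lra.
Qed.

Lemma firing_cvg (e : nat -> R) x m : (forall n, 0 < e n < 1) -> e @ \oo --> (1 : R) ->
  (forall k, 0 < x k) ->
  (1 - e n) * (firing (- ln (e n)) x m)%:R @[n --> \oo] --> \sum_(k < m) x k.
Proof.
move=> e01 e1 x0; set S := \sum_(k < m) x k.
have he : (1 - e n) * (S + m%:R) @[n --> \oo] --> (0 : R).
  rewrite -(mul0r (S + m%:R)); apply: cvgMl; rewrite -[X in _ --> X](subrr (1 : R)).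
  by apply: cvgB => //; exact: cvg_cst.
apply: (@squeeze_cvgr _ _ _ _ (fun n => S - (1 - e n) * (S + m%:R))
    (fun n => S + (1 - e n) * (S + m%:R))).
- near=> n; have := firing_bound m (e01 n) x0; rewrite -/S ler_norml => /andP[h1 h2].
  by apply/andP; split; lra.
- by rewrite -[X in _ --> X]subr0; apply: cvgB => //; exact: cvg_cst.
- by rewrite -[X in _ --> X]addr0; apply: cvgD => //; exact: cvg_cst.
Unshelve. all: by end_near. Qed.

End RenewalCoins.

(** * PushTASEP as a chain of events, for fixed clocks with the almost sure properties *)

Section EventChain.
Context {R : realType} (d : nat) (E : nat -> nat -> R) (x0 : nat -> int).
Hypotheses (d_gt0 : (0 < d)%N)
  (E_gt0 : forall i k, (i < d)%N -> 0 < E i k)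
  (no_ties : forall i j m n, (i < d)%N -> (j < d)%N -> i != j ->
     ring_time E i m != ring_time E j n)
  (ring_unbounded : forall i (M : R), (i < d)%N -> exists n, M < ring_time E i n).

Let cnt k := (ptasep_events d E x0 k).1.
Let pos k := (ptasep_events d E x0 k).2.

(** The default is never taken: by [next_ringP] the minimum exists and, without ties, is strict. *)
Definition next_ring k : 'I_d :=
  odflt (Ordinal d_gt0) (argmin_ord (fun i : 'I_d => ring_time E i (cnt k i))).
Let idx := next_ring.

Let tau k := ring_time E (idx k) (cnt k (idx k)).

Lemma next_ringP k :
  argmin_ord (fun i : 'I_d => ring_time E i (cnt k i)) = Some (idx k) /\
  forall j : 'I_d, j != idx k -> tau k < ring_time E j (cnt k j).
Proof.
rewrite /tau /idx /next_ring; set f := fun i : 'I_d => ring_time E i (cnt k i).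
rewrite /argmin_ord; case: pickP => [i /forallP iP /=|N].
  split=> // j ji; have /orP[//|/andP[/eqP fij _]] := iP j.
  by have := @no_ties i j (cnt k i) (cnt k j) (ltn_ord i) (ltn_ord j);
    rewrite eq_sym ji => /(_ isT) /eqP.
have [i _ imin] := @Order.TotalTheory.arg_minP _ _ _ (Ordinal d_gt0) xpredT f isT.
have /forallP := N i; case => j.
have := imin j isT; rewrite le_eqVlt => /orP[/eqP fij|->//].
rewrite fij eqxx /=; have [->|ij] := eqVneq i j; first by rewrite leqnn orbT.
by have := @no_ties i j (cnt k i) (cnt k j) (ltn_ord i) (ltn_ord j) ij;
  rewrite /f in fij; rewrite fij eqxx.
Qed.

Lemma ptasep_cntS k j : cnt k.+1 j = (cnt k j + (j == idx k))%N.
Proof.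
rewrite {1}/cnt /=; have [+ _] := next_ringP k; rewrite /cnt.
case: (ptasep_events d E x0 k) => cn x /= ->.
by rewrite /=; case: (j =P _) => _; rewrite ?addn1 ?addn0.
Qed.

Lemma ptasep_posS k : pos k.+1 = push (pos k) (idx k).
Proof.
rewrite {1}/pos /=; have [+ _] := next_ringP k; rewrite /cnt /pos.
by case: (ptasep_events d E x0 k) => cn x /= ->.
Qed.

Lemma ptasep_evtimeE k : ptasep_evtime d E x0 k = tau k.
Proof.
rewrite /ptasep_evtime; have [+ _] := next_ringP k; rewrite /tau /cnt.
by case: (ptasep_events d E x0 k) => cn x /= ->.
Qed.

Lemma ring_timeS i m : ring_time E i m.+1 = ring_time E i m + E i m.+1.
Proof. by rewrite /ring_time big_ord_recr. Qed.

Lemma evtime_ltS k (i : 'I_d) : tau k < ring_time E i (cnt k.+1 i).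
Proof.
rewrite ptasep_cntS; have [ik|ik] := eqVneq i (idx k).
  by rewrite ik eqxx addn1 ring_timeS ltrDl E_gt0.
rewrite (_ : (_ == _) = false) ?addn0; last by apply/negbTE.
exact: (next_ringP k).2.
Qed.

Lemma evtime_lt : {homo tau : k l / (k < l)%N >-> k < l}.
Proof.
apply: homo_ltn => [y x z|k]; first exact: lt_trans.
exact: lt_le_trans (evtime_ltS k (idx k.+1)) (lexx _).
Qed.

Lemma evtime_gt0 k : 0 < tau k.
Proof.
rewrite /tau /ring_time big_ord_recr /= ltr_wpDl ?E_gt0 //.
by apply: sumr_ge0 => l _; rewrite ltW // E_gt0.
Qed.

Lemma cnt_rung J i m : (i < d)%N -> (m < cnt J i)%N ->
  exists2 k, (k < J)%N & i = idx k /\ cnt k i = m.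
Proof.
move=> id; elim: J => [//|J IH]; rewrite ptasep_cntS.
have [iJ|iJ] := eqVneq i (idx J).
  rewrite addn1 ltnS leq_eqVlt => /orP[/eqP ->|/IH[k kJ h]]; first by exists J.
  by exists k => //; exact: ltnW.
rewrite addn0 => /IH[k kJ h].
by exists k => //; exact: ltnW.
Qed.

Lemma sum_cnt k : (\sum_(i < d) cnt k i = k)%N.
Proof.
elim: k => [|k IH]; first by rewrite big1.
under eq_bigr do rewrite ptasep_cntS.
rewrite big_split /= IH (bigD1 (idx k)) //= eqxx big1 ?addn0 ?addn1 // => i ik.
by rewrite (_ : (_ == _) = false) //; apply/negbTE.
Qed.

(** Pigeonhole: after one event more than the sum of the [n i], some clock [i] has rung more than
    [n i] times, and its ring of index [n i] is an event later than [M]. *)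
Lemma evtime_unbounded M : exists k, M < tau k.
Proof.
have [n nP] : {n : 'I_d -> nat & forall i : 'I_d, M < ring_time E i (n i)}.
  apply: (@choice _ _ (fun (i : 'I_d) n => M < ring_time E i n)) => i.
  exact: ring_unbounded.
pose k := (\sum_(i < d) n i).+1.
have [/forallP h|] := boolP [forall i : 'I_d, cnt k i <= n i]%N.
  have : (\sum_(i < d) cnt k i <= \sum_(i < d) n i)%N by apply: leq_sum => i _.
  by rewrite sum_cnt ltnn.
rewrite negb_forall => /existsP[i]; rewrite -ltnNge => /cnt_rung[//|k' _ [ik ck]].
exists k'; move: (nP i); rewrite -ck /tau.
by rewrite (_ : idx k' = i) //; exact/esym/val_inj.
Qed.

Lemma pushtasepE t k (i : 'I_d) : (forall k', (k' < k)%N -> tau k' <= t) -> t < tau k ->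
  pushtasep E x0 t i = pos k i.
Proof.
move=> kt tk; rewrite /pushtasep; case: pselect => [h|[]]; last first.
  by move=> M; have [k' ?] := evtime_unbounded M; exists k'; rewrite ptasep_evtimeE.
case: pselect => [h'|[]]; last by exists k; rewrite ptasep_evtimeE.
case: ex_minnP => l; rewrite ptasep_evtimeE => tl lmin.
have lk : (l <= k)%N by apply: lmin; rewrite ptasep_evtimeE.
have kl : (k <= l)%N by rewrite leqNgt; apply/negP => /kt; rewrite leNgt tl.
by rewrite (@anti_leq l k) // lk.
Qed.

Lemma ex_evtime_gt t : exists2 k, (forall k', (k' < k)%N -> tau k' <= t) & t < tau k.
Proof.
case: (ex_minnP (evtime_unbounded t)) => k tk kmin; exists k => // k' kk'.
by rewrite leNgt; apply/negP => /kmin; rewrite leqNgt kk'.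
Qed.

Lemma pushtasep_cadlag : cadlag (pushtasep (d := d) E x0).
Proof.
move=> t t0; split.
  have [k kt tk] := ex_evtime_gt t.
  exists (tau k - t); first by rewrite subr_gt0.
  move=> s ts; rewrite addrC subrK => sk.
  by apply/funext => i; rewrite !(@pushtasepE _ k) // => k' /kt /le_trans; apply.
move=> t_gt0.
have exk : exists k, t <= tau k by have [k /ltW ?] := evtime_unbounded t; exists k.
case: (ex_minnP exk) => k tk kmin.
have kt k' : (k' < k)%N -> tau k' < t.
  by move=> kk'; rewrite ltNge; apply/negP => /kmin; rewrite leqNgt kk'.
have [del del0 dP] : exists2 del, 0 < del & forall k', (k' < k)%N -> tau k' <= t - del.
  case: k kt {tk kmin} => [|k] kt; first by exists 1.
  exists (t - tau k) => [|k' k'k]; first by rewrite subr_gt0 kt.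
  rewrite opprB addrC subrK; move: k'k; rewrite ltnS leq_eqVlt.
  by move=> /orP[/eqP->//|/evtime_lt /ltW].
exists del => //; exists (fun i => pos k i) => s ts st; apply/funext => i.
apply: pushtasepE => [k' /dP /le_trans|]; last exact: lt_le_trans tk.
by apply; exact: ltW.
Qed.


(** * SBBS and PushTASEP driven by the same clocks *)

Section Coupling.
Context (c : option nat) (z0 : nat -> bool).
Hypotheses (c_gt0 : below_cap c 0) (z0_balls : has_d_balls z0 d)
  (x0E : forall j, (j < d)%N -> x0 j = (ball_pos z0 j)%:Z).

(** The sweep that should perform the PushTASEP event [k]: the firing of the same ring of the same
    clock. *)
Let D lam k := firing lam (E (idx k)) (cnt k (idx k)).+1.

(** The firings keep the strict order of the events up to [J], and rings outside these events fire
    after [D lam J]. Hence no two coins come up in the same sweep until then. *)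
Let aligned lam J :=
  (forall k, (k < J)%N -> D lam k < D lam k.+1)%N /\
  forall i : 'I_d, (D lam J < firing lam (E i) (cnt J.+1 i).+1)%N.

Lemma aligned_lt lam J k l : aligned lam J -> (k < l)%N -> (l <= J)%N ->
  (D lam k < D lam l)%N.
Proof.
move=> [DS _]; elim: l => // l IH; rewrite ltnS leq_eqVlt => /orP[/eqP ->|kl] lJ.
  exact: DS.
by apply: ltn_trans (DS _ lJ); apply: IH => //; exact: ltnW.
Qed.

Lemma aligned_inj lam J k l : aligned lam J -> (k <= J)%N -> (l <= J)%N ->
  D lam k = D lam l -> k = l.
Proof.
move=> al kJ lJ e; case: (ltngtP k l) => // kl.
  by have := aligned_lt al kl lJ; rewrite e ltnn.
by have := aligned_lt al kl kJ; rewrite e ltnn.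
Qed.

Lemma aligned_fired lam J (i : nat) m : 0 < lam -> aligned lam J -> (i < d)%N ->
  (firing lam (E i) m.+1 <= D lam J)%N ->
  exists k, [/\ (k <= J)%N, i = idx k & firing lam (E i) m.+1 = D lam k].
Proof.
move=> lam0 [_ al] id mJ.
have Ei k : 0 < E i k by exact: E_gt0.
have mc : (m < cnt J.+1 i)%N.
  rewrite ltnNge; apply/negP => cm; have := al (Ordinal id) => /=.
  by rewrite ltnNge => /negP; apply; apply: leq_trans mJ; apply: firing_le.
have [k kJ [ik ck]] := cnt_rung id mc.
by exists k; split => //; rewrite /D -ik ck.
Qed.

Lemma sbbs_traj_events lam J n k : 0 < lam -> aligned lam J -> (k <= J)%N ->
  (forall k', (k' < k)%N -> (D lam k' <= n)%N) -> (n < D lam k)%N ->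
  exists2 p, ball_positions d (sbbs_traj c (renewal_coins lam E) z0 n) p &
    forall j, (j < d)%N -> pos k j = (p j)%:Z.
Proof.
move=> lam0 al.
have EE i l : (i < d)%N -> 0 < E i l by exact: E_gt0.
have coinP (j : nat) m : (j < d)%N -> reflect (exists l, firing lam (E j) l.+1 = m.+1)
    (renewal_coins lam E m j).
  by move=> jd; apply: renewal_coinP => // l; exact: E_gt0.
have D0 l : (0 < D lam l)%N.
  rewrite /D firingS; have := @gap_gt0 _ lam (E (idx l) (cnt l (idx l))) lam0.
  by rewrite E_gt0 // => /(_ isT); lia.
elim: n k => [|n IH] k kJ kn nk.
  have -> : k = 0%N by case: k kn {kJ nk} => // k /(_ 0%N isT); have := D0 0%N; lia.
  by exists (ball_pos z0) => //=; exact: has_d_balls_positions.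
(* Sweep [n + 1] either performs an event, which is then event [k - 1], or has no coin up. *)
have [[k' kk' Dk']|N] := pselect (exists2 k', (k' < k)%N & D lam k' = n.+1).
  have kE : k = k'.+1.
    apply/eqP; rewrite eqn_leq kk' andbT leqNgt; apply/negP => k'k.
    have := aligned_lt al (ltnSn k') (leq_trans (ltnW k'k) kJ).
    by have := kn _ k'k; rewrite Dk'; lia.
  have k'J : (k' <= J)%N by apply: leq_trans kJ; rewrite kE.
  have [| |p zp pE] := IH k' k'J.
  - by move=> l lk'; have := aligned_lt al lk' k'J; rewrite Dk'.
  - by rewrite Dk'.
  have [|p' zp' p'E] := @sbbs_step_single _ _ _ zp c (renewal_coins lam E n) (idx k')
      (pos k') c_gt0 (ltn_ord _) _ pE.
    move=> j jd; apply/(coinP _ _ jd)/eqP => [[l lE]|->]; last first.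
      by exists (cnt k' (idx k')).
    (* Any success in this sweep is an event with the same [D] as [k'], hence [k'] itself. *)
    have [|l' [l'J jl' l'E]] := aligned_fired (m := l) lam0 al jd.
      rewrite lE -Dk'; move: k'J; rewrite leq_eqVlt => /orP[/eqP->//|k'J].
      by apply/ltnW/(aligned_lt al).
    by rewrite jl'; congr (nat_of_ord (idx _)); apply: (aligned_inj al); rewrite // -l'E lE.
  by exists p' => // j jd; rewrite kE ptasep_posS p'E.
have [| |p zp pE] := IH k kJ.
- move=> l lk; have := kn _ lk; rewrite leq_eqVlt => /orP[/eqP lE|//].
  by case: N; exists l.
- exact: ltnW.
exists p => //=; apply: sbbs_step_none => // j jd.
apply/negP => /(coinP _ _ jd)[l lE].
have DkJ : (D lam k <= D lam J)%N.
  by move: kJ; rewrite leq_eqVlt => /orP[/eqP->//|kJ]; apply/ltnW/(aligned_lt al).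
have [|l' [l'J jl' l'E]] := aligned_fired (m := l) lam0 al jd; first by rewrite lE; lia.
apply: N; exists l'; last by rewrite -l'E.
rewrite ltnNge; apply/negP => kl'.
move: kl'; rewrite leq_eqVlt => /orP[/eqP kl'|/(aligned_lt al)/(_ l'J)].
  by move: nk; rewrite kl' -l'E lE ltnn.
by rewrite -l'E lE; lia.
Qed.

Let sig e k := (1 - e) * (D (- ln e) k)%:R.

Lemma sbbs_scaled_events e J t k (i : 'I_d) : 0 < e < 1 -> aligned (- ln e) J ->
  (k <= J)%N -> 0 <= t -> (forall k', (k' < k)%N -> sig e k' <= t) -> t < sig e k ->
  sbbs_scaled c z0 e (renewal_coins (- ln e) E) t i = pos k i.
Proof.
move=> /andP[e0 e1] al kJ t0 kt tk.
have e'0 : 0 < 1 - e by rewrite subr_gt0.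
have t'0 : 0 <= t / (1 - e) by rewrite divr_ge0 // ltW.
have lam0 : 0 < - ln e by rewrite oppr_gt0 ln_lt0 // e0.
have [| |p zp pE] := @sbbs_traj_events _ J (Num.truncn (t / (1 - e))) k lam0 al kJ.
- by move=> k' /kt; rewrite truncn_ge_nat // ler_pdivlMr // mulrC.
- by rewrite truncn_lt_nat // ltr_pdivrMr // mulrC.
by rewrite /sbbs_scaled pE // (ball_posE zp).
Qed.

Let inc (s : nat -> R) k := if k is k'.+1 then s k'.+1 - s k' else s 0%N.

Lemma sum_inc s k : \sum_(l <- iota 0 k.+1) inc s l = s k.
Proof.
elim: k => [|k IH]; first by rewrite big_seq1.
by rewrite -addn1 iotaD big_cat IH /= add0n big_seq1 /= subrKC.
Qed.

Lemma J1_conv_events (e : nat -> R) : (forall n, 0 < e n < 1) -> e @ \oo --> (1 : R) ->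
  J1_conv (fun n => sbbs_scaled (d := d) c z0 (e n) (renewal_coins (- ln (e n)) E))
          (pushtasep E x0).
Proof.
move=> e01 e1; apply: J1_convI => K.
(* Finitely many events decide the paths on [[0, K]], so every requirement below is a finite
   conjunction of strict inequalities true in the limit, hence true eventually. *)
have [J KJ] := evtime_unbounded K%:R.
have sig_cvg k : sig (e n) k @[n --> \oo] --> tau k.
  by apply: firing_cvg => // l; exact: E_gt0.
have inc_cvg k : inc (sig (e n)) k @[n --> \oo] --> inc tau k.
  by case: k => [|k] /=; [exact: sig_cvg|apply: cvgB; exact: sig_cvg].
have inc_gt0 k : 0 < inc tau k.
  by case: k => [|k] /=; [exact: evtime_gt0|rewrite subr_gt0 evtime_lt].
pose del : R := K.+1%:R^-1.
have del0 : 0 < del by rewrite invr_gt0.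
have ed : expR (- del) < 1 by rewrite -expR0 ltr_expR oppr_lt0.
have ed' : 1 < expR del by rewrite -[ltLHS]expR0 ltr_expR.
near=> n.
have lam0 : 0 < - ln (e n) by rewrite oppr_gt0 ln_lt0 // e01.
have e'0 : 0 < 1 - e n by rewrite subr_gt0; case/andP: (e01 n).
have al : aligned (- ln (e n)) J.
  split=> [k kJ|i].
    have : 0 < inc (sig (e n)) (Ordinal (kJ : (k.+1 < J.+1)%N)).
      move: (Ordinal _); near: n; apply: filter_forall => k'.
      exact: (cvgr_gt _ (inc_cvg k')).
    by rewrite /= subr_gt0 ltr_pM2l // ltr_nat.
  suff : sig (e n) J < (1 - e n) * (firing (- ln (e n)) (E i) (cnt J.+1 i).+1)%:R.
    by rewrite ltr_pM2l // ltr_nat.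
  rewrite -subr_gt0; move: i; near: n; apply: filter_forall => i.
  have : tau J < ring_time E i (cnt J.+1 i) by exact: evtime_ltS.
  rewrite -subr_gt0 => h; apply: cvgr_gt h; apply: cvgB => //.
  by apply: firing_cvg => // l; exact: E_gt0.
(* The time change sends each rescaled firing time [sig (e n) k] to [tau k] and is linear in
   between. Its slopes are quotients of increments and tend to 1 because the limit increments are
   positive. *)
pose l := [seq (inc (sig (e n)) k, inc tau k) | k <- iota 0 J.+1].
have slopes : forall k : 'I_J.+1, [&& 0 < inc (sig (e n)) k,
    expR (- del) * inc (sig (e n)) k <= inc tau k &
    inc tau k <= expR del * inc (sig (e n)) k].
  near: n; apply: filter_forall => k; near=> n; apply/and3P; split.
  - by near: n; exact: (cvgr_gt _ (inc_cvg k)).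
  - apply/ltW; near: n; apply: (@cvgr_lt _ _ _ _ _ (expR (- del) * inc tau k)).
      by apply: cvgMr => //; exact: inc_cvg.
    by rewrite gtr_pMl.
  - apply/ltW; near: n; apply: (@cvgr_gt _ _ _ _ _ (expR del * inc tau k)).
      by apply: cvgMr => //; exact: inc_cvg.
    by rewrite ltr_pMl.
have sl : slopes_in (expR (- del)) (expR del) l.
  apply/allP => ab /mapP[k]; rewrite mem_iota /= add0n => kJ -> /=.
  exact: (slopes (Ordinal kJ)).
have tc := pl_map_time_change (ltW ed) (ltW ed') (expR_gt0 _) sl.
exists (pl_map l); split => //.
  by move=> s t _ ts; apply: pl_map_ln_slope ts => //; exact: ltW.
move=> t t0 tK; apply/funext => i.
have lE k : (k <= J)%N -> pl_map l (sig (e n) k) = tau k.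
  move=> kJ; move: sl; rewrite /l -(subnKC (kJ : (k.+1 <= J.+1)%N)) iotaD map_cat.
  rewrite /slopes_in all_cat => /andP[sl1 sl2].
  have := pl_map_sum sl1 sl2; rewrite !big_map.
  by rewrite !sum_inc.
have tJ : t < sig (e n) J.
  by apply: (le_lt_trans tK); near: n; apply: cvgr_gt KJ; exact: sig_cvg.
case: (ex_minnP (ex_intro (fun k => t < sig (e n) k) J tJ)) => k tk kmin.
have kJ : (k <= J)%N by exact: kmin.
have kt k' : (k' < k)%N -> sig (e n) k' <= t.
  by move=> kk'; rewrite leNgt; apply/negP => /kmin; rewrite leqNgt kk'.
have incr u v : u < v -> pl_map l u < pl_map l v.
  move=> uv; have /andP[h _] := pl_map_incr (ltW ed) (ltW ed') sl uv.
  by rewrite -subr_gt0 (lt_le_trans _ h) // mulr_gt0 ?expR_gt0 // subr_gt0.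
rewrite (sbbs_scaled_events i (e01 n) al kJ) //; apply/esym/pushtasepE.
  move=> k' k'k; rewrite -lE; last exact: leq_trans (ltnW k'k) kJ.
  by have := kt _ k'k; rewrite le_eqVlt => /orP[/eqP->//|/incr/ltW].
by rewrite -lE //; exact: incr.
Unshelve. all: by end_near. Qed.

End Coupling.
End EventChain.

(** * The law of the renewal coins *)

Section IntervalLaw.
Context {R : realType}.

(** The intervals []a, b]] with optional ends arise as differences of the events [E <= b], whose
    joint law is the given one. *)
Definition in_range (ab : option R * option R) (y : R) : bool :=
  (if ab.1 is Some a then a < y else true) && (if ab.2 is Some b then y <= b else true).

Definition range_mass (ab : option R * option R) : R :=
  (if ab.2 is Some b then exp1_cdf b else 1) - (if ab.1 is Some a then exp1_cdf a else 0).

Definition range_wf (ab : option R * option R) : bool :=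
  match ab with (Some a, Some b) => a <= b | _ => true end.

Context {dsp : measure_display} {U : measurableType dsp} (Q : probability U R)
  (E : U -> nat -> nat -> R) (iidE : iid_exp1 Q E).

Let ev (s : seq (nat * nat)) (h : nat * nat -> option R * option R) :=
  [set w | forall j, j \in s -> in_range (h j) (E w j.1 j.2)].

Lemma measurable_in_range ab i k : measurable [set w | in_range ab (E w i k)].
Proof.
have mE a : measurable [set w | E w i k <= a] by case: iidE => + _; exact.
case: ab => a b; rewrite /in_range /=.
rewrite (_ : [set w | _] = [set w | (if a is Some a' then a' < E w i k else true) = true] `&`
   [set w | (if b is Some b' then E w i k <= b' else true) = true]); last first.
  by apply/seteqP; split=> w /= => [/andP[]|[-> ->]].
apply: measurableI; last first.
  case: b => [b|]; first exact: mE.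
  by rewrite (_ : [set _ | _] = setT) //; apply/seteqP; split.
case: a => [a|]; last by rewrite (_ : [set _ | _] = setT) //; apply/seteqP; split.
rewrite (_ : [set _ | _] = ~` [set w | E w i k <= a]); first exact: measurableC.
apply/seteqP; split=> w /=; first by move=> ?; apply/negP; rewrite -ltNge.
by move/negP; rewrite -ltNge.
Qed.

Lemma measurable_ranges s h : measurable (ev s h).
Proof.
elim: s => [|j s IH]; first by rewrite (_ : ev _ _ = setT) //; apply/seteqP; split.
rewrite (_ : ev _ _ = [set w | in_range (h j) (E w j.1 j.2)] `&` ev s h); last first.
  apply/seteqP; split=> w /=.
    by move=> H; split=> [|k ks]; apply: H; rewrite inE ?eqxx // ks orbT.
  by move=> [Hj Hs] k; rewrite inE => /orP[/eqP->|/Hs].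
by apply: measurableI => //; exact: measurable_in_range.
Qed.

Lemma prob_upper_ranges s h : uniq s -> (forall j, j \in s -> (h j).1 = None) ->
  Q (ev s h) = (\prod_(j <- s) range_mass (h j))%:E.
Proof.
(* The joint law is given for real thresholds, so coordinates without an upper bound are dropped;
   their mass is 1. *)
move=> us h1; pose s' := [seq j <- s | (h j).2 != None].
have -> : ev s h = [set w | forall j, j \in s' -> E w j.1 j.2 <= odflt 0 (h j).2].
  apply/seteqP; split=> w /= H j.
    rewrite mem_filter => /andP[+ /[dup] js /H]; rewrite /in_range h1 //.
    by case: (h j).2.
  move=> js; rewrite /in_range h1 //=; have := H j; rewrite mem_filter js andbT.
  by case: (h j).2 => // b /(_ isT).
case: iidE => _ ->; last exact: filter_uniq.
congr EFin; rewrite big_filter big_mkcond /= big_seq [RHS]big_seq.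
apply: eq_bigr => j js; rewrite /range_mass h1 //.
by case: (h j).2 => [b|] /=; rewrite subr0.
Qed.

(* Each lower constraint [a < E j] is removed by inclusion-exclusion. *)
Lemma prob_ranges s h : uniq s -> (forall j, j \in s -> range_wf (h j)) ->
  Q (ev s h) = (\prod_(j <- s) range_mass (h j))%:E.
Proof.
move=> us hwf.
(* Induction on a list [s1] of the coordinates that may still carry a lower bound. *)
suff H (s1 : seq (nat * nat)) h' : (forall j, j \in s -> range_wf (h' j)) ->
    (forall j, j \in s -> j \notin s1 -> (h' j).1 = None) ->
    Q (ev s h') = (\prod_(j <- s) range_mass (h' j))%:E.
  by apply: (H s) => // j ->.
elim: s1 h' => [|j s1 IH] h' wf h1; first by apply: prob_upper_ranges => // j /h1; apply.
have [[js]|N] := pselect (j \in s /\ (h' j).1 <> None); last first.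
  apply: IH => // k ks ks1; have [kj|kj] := eqVneq k j.
    by apply: contrapT => e; apply: N; rewrite -kj.
  by apply: h1; rewrite // inE negb_or kj.
case hj : (h' j) => [[a|] b] //= _.
(* Since [a <= b], the event for []a, b]] is the one for []-oo, b]] minus the one for []-oo, a]],
   and both have one lower bound less. *)
pose hB k := if k == j then (None, b) else h' k.
pose hC k := if k == j then (None, Some a) else h' k.
have ab : if b is Some b' then a <= b' else true.
  by have := wf _ js; rewrite hj; case: (b).
have sub : ev s hC `<=` ev s hB.
  move=> w H k ks; have := H k ks; rewrite /hC /hB; case: eqP => // _.
  by rewrite /in_range /=; case: b ab {hj hB} => // b ab /le_trans; apply.
have -> : ev s h' = ev s hB `\` ev s hC.
  apply/seteqP; split=> w.
    move=> H; split=> [k ks|/(_ j js)].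
      have := H k ks; rewrite /hB; case: eqP => // ->; rewrite hj /in_range /=.
      by case/andP.
    by rewrite /hC eqxx /in_range /= leNgt; have := H j js; rewrite hj => /andP[-> _].
  move=> [HB HC] k ks; have := HB k ks; rewrite /hB; case: eqP => // -> Hb.
  rewrite hj /in_range /=; move: Hb; rewrite /in_range /= => ->; rewrite andbT.
  rewrite ltNge; apply/negP => Ea; apply: HC => l ls; have := HB l ls.
  rewrite /hC /hB; case: eqP => // ->; by rewrite /in_range /= Ea.
rewrite measureD //; [|exact: measurable_ranges..|]; last first.
  by rewrite (le_lt_trans (probability_le1 _ (measurable_ranges _ _))) ?ltry.
rewrite setIidr //.
transitivity ((\prod_(k <- s) range_mass (hB k))%:E -
    (\prod_(k <- s) range_mass (hC k))%:E)%E; first congr (_ - _)%E; try apply: IH.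
- by move=> k ks; rewrite /hB; case: eqP => // kj; exact: wf.
- move=> k ks ks1; rewrite /hB; case: eqP => // /eqP kj.
  by apply: h1; rewrite // inE negb_or kj.
- by move=> k ks; rewrite /hC; case: eqP => // kj; exact: wf.
- move=> k ks ks1; rewrite /hC; case: eqP => // /eqP kj.
  by apply: h1; rewrite // inE negb_or kj.
have rem (g g' : nat * nat -> option R * option R) : (forall k, k != j -> g k = g' k) ->
    \prod_(k <- rem j s) range_mass (g k) = \prod_(k <- rem j s) range_mass (g' k).
  move=> gg'; rewrite big_seq [RHS]big_seq; apply: eq_bigr => k.
  by rewrite mem_rem_uniq // inE => /andP[kj _]; rewrite gg'.
rewrite !(big_rem j js) /= (rem hB h') => [|k /negPf kj]; last by rewrite /hB kj.
rewrite (rem hC h') => [|k /negPf kj]; last by rewrite /hC kj.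
rewrite -EFinB -mulrBl; congr (_ * _)%:E.
by rewrite /hB /hC eqxx hj /range_mass /=; ring.
Qed.

End IntervalLaw.

Section RenewalLaw.
Context {R : realType}.
Implicit Types (lam : R) (x : nat -> R) (v : nat -> bool).

Fixpoint word_state v (n : nat) : nat * nat :=
  match n with
  | 0 => (0%N, 0%N)
  | n'.+1 => let: (m, r) := word_state v n' in if v n' then (m.+1, 0%N) else (m, r.+1)
  end.

(* the constraints on the holding times expressing that the first [n] renewal
   coins spell the word [v] *)
Fixpoint word_ranges lam v (n : nat) : nat -> option R * option R :=
  match n with
  | 0 => fun=> (None, None)
  | n'.+1 => let: (m, r) := word_state v n' in
    fun k => if k == m then
               if v n' then ((word_ranges lam v n' m).1, Some (r.+1%:R * lam))
               else (Some (r.+1%:R * lam), None)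
             else word_ranges lam v n' k
  end.

(** The running clock [m] is only known to outlast [r] failures. For [r = 0] no bound [0] is
    recorded, so that [renewal_wordP] holds for every [x], positive or not. *)
Lemma word_ranges_current lam v n : let: (m, r) := word_state v n in
  [/\ (m <= n)%N,
      word_ranges lam v n m = (if r is 0 then None else Some (r%:R * lam), None) &
      forall k, (m < k)%N -> word_ranges lam v n k = (None, None)].
Proof.
elim: n => [//|n] /=; case: word_state => m r [mn wm wk]; case: ifP => vn.
  split=> // [|k mk]; first by rewrite gtn_eqF // wk.
  by rewrite gtn_eqF ?wk // ltnW.
split=> [| |k mk]; [exact: leqW|by rewrite eqxx|by rewrite gtn_eqF // wk].
Qed.

Lemma word_ranges_wf lam v n k : 0 < lam -> range_wf (word_ranges lam v n k).
Proof.
move=> lam0; elim: n k => //= n IH k; have := word_ranges_current lam v n.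
case: word_state => m r [mn wm wk]; case: eqP => [_|_]; last exact: IH.
case: ifP => // _; rewrite wm; case: r {wm} => //= r.
by rewrite ler_pM2r // ler_nat.
Qed.

Lemma renewal_wordP lam x v n : 0 < lam ->
  (forall t, (t < n)%N -> renewal_coin lam x t = v t) <->
  (forall k, in_range (word_ranges lam v n k) (x k)).
Proof.
move=> lam0.
have stE m : (forall t, (t < m)%N -> renewal_coin lam x t = v t) ->
    renewal_state lam x m = word_state v m.
  elim: m => //= m IH H; rewrite -IH => [|t tm]; last by apply: H; exact: ltnW.
  by have := H m (ltnSn m); rewrite /renewal_coin; case: renewal_state => a b ->.
elim: n => [|n IH]; first by split.
have -> : (forall t, (t < n.+1)%N -> renewal_coin lam x t = v t) <->
    (forall t, (t < n)%N -> renewal_coin lam x t = v t) /\ renewal_coin lam x n = v n.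
  split=> [H|[H Hn] t]; first by split=> [t tn|]; apply: H => //; exact: ltnW.
  by rewrite ltnS leq_eqVlt => /orP[/eqP->|/H].
have : (forall t, (t < n)%N -> renewal_coin lam x t = v t) ->
    renewal_coin lam x n = (x (word_state v n).1 <= (word_state v n).2.+1%:R * lam).
  by move=> /stE; rewrite /renewal_coin => ->; case: word_state.
rewrite /=; have := word_ranges_current lam v n.
case: word_state => m r /= [mn wm wk] cE; split.
  move=> [Hn vn] k; have Hr := IH.1 Hn; rewrite cE // in vn.
  case: eqP => [->|_]; last exact: Hr.
  rewrite -vn; have := Hr m; rewrite wm /in_range /= andbT.
  by case: ifP => //= [-> ->//|/negbT]; rewrite -ltNge => ->.
move=> H.
have Hr k : in_range (word_ranges lam v n k) (x k).
  have := H k; case: eqP => [->|_ //]; rewrite wm /in_range /= andbT.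
  case: ifP => _ /=; first by case/andP.
  case: (r) => //= r'; rewrite andbT; apply: lt_trans.
  by rewrite ltr_pM2r // ltr_nat.
have Hn := IH.2 Hr; split=> //; rewrite cE //.
have := H m; rewrite eqxx /in_range; case: ifP => //= _; first by case/andP.
by rewrite andbT ltNge => /negPf.
Qed.

Lemma exp1_cdf_ln (e : R) r : 0 < e < 1 -> exp1_cdf (r%:R * - ln e) = 1 - e ^+ r.
Proof.
move=> /andP[e0 e1]; rewrite /exp1_cdf ltNge mulr_ge0 //=; last first.
  by rewrite oppr_ge0 ln_le0 // ltW.
by rewrite mulrN opprK expRM_natl lnK.
Qed.

(** A new letter changes only the range of the running clock, whose mass [e ^ r] becomes
    [e ^ r * (1 - e)] or [e ^ r.+1]. That clock has index at most the length of the word, so it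
    appears in the product. *)
Lemma word_ranges_mass (e : R) v n N : 0 < e < 1 -> (n < N)%N ->
  \prod_(k <- iota 0 N) range_mass (word_ranges (- ln e) v n k) =
  \prod_(t <- iota 0 n) (if v t then 1 - e else e).
Proof.
move=> e01; elim: n => [|n IH] nN.
  by rewrite big_nil big1 // => k _; rewrite /range_mass subr0.
rewrite -addn1 iotaD big_cat /= add0n big_seq1 -IH; last exact: ltnW.
have := word_ranges_current (- ln e) v n; rewrite addn1 /=.
case: word_state => m r /= [mn wm wk].
have mN : m \in iota 0 N by rewrite mem_iota /=; lia.
rewrite !(bigD1_seq m) ?iota_uniq //= eqxx mulrAC; congr (_ * _); last first.
  by apply: eq_bigr => k /negPf ->.
have e0 : e ^+ r = 1 - (if r is 0 then 0 else exp1_cdf (r%:R * - ln e)).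
  by case: (r) => [|r']; rewrite ?subr0 // exp1_cdf_ln // opprB subrKC.
rewrite wm /range_mass /=; case: ifP => _ /=; rewrite exp1_cdf_ln //.
  by case: (r) e0 => [|r'] /= e0; rewrite ?exp1_cdf_ln // !exprS; ring.
by case: (r) e0 => [|r'] /= e0; rewrite ?exp1_cdf_ln // !exprS; ring.
Qed.

Context {dsp : measure_display} {U : measurableType dsp} (Q : probability U R)
  (E : U -> nat -> nat -> R) (iidE : iid_exp1 Q E).

Lemma renewal_box_event lam (v : nat -> nat -> bool) (I : seq nat) n : 0 < lam ->
  [set w | forall t i, (t < n)%N -> i \in I -> renewal_coins lam (E w) t i = v t i] =
  [set w | forall j, j \in [seq (i, k) | i <- I, k <- iota 0 n.+1] ->
     in_range (word_ranges lam (v^~ j.1) n j.2) (E w j.1 j.2)].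
Proof.
move=> lam0; apply/seteqP; split=> w H.
  move=> j /allpairsP[[i k] /= [iI _ ->]] /=.
  by apply: (renewal_wordP (E w i) (v^~ i) n lam0).1 => t tn; exact: H.
move=> t i tn iI; apply: (renewal_wordP (E w i) (v^~ i) n lam0).2 => // k.
have [kn|kn] := ltnP k n.+1.
  by apply: (H (i, k)); apply/allpairsP; exists (i, k); rewrite mem_iota.
have := word_ranges_current lam (v^~ i) n.
by case: word_state => m r [mn _ ->] //; exact: leq_ltn_trans kn.
Qed.

Lemma renewal_box_prob (e : R) (v : nat -> nat -> bool) n : 0 < e < 1 ->
  Q [set w | forall t i, (t < n)%N -> i \in iota 0 n ->
      renewal_coins (- ln e) (E w) t i = v t i] =
  (\prod_(i <- iota 0 n) \prod_(t <- iota 0 n) (if v t i then 1 - e else e))%:E.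
Proof.
move=> e01; have lam0 : 0 < - ln e by rewrite oppr_gt0 ln_lt0.
rewrite renewal_box_event // (prob_ranges iidE); last 2 first.
- by apply: allpairs_uniq; rewrite ?iota_uniq // => -[? ?] [? ?].
- by move=> j _; exact: word_ranges_wf.
rewrite big_allpairs; congr EFin; apply: eq_bigr => i _.
exact: (word_ranges_mass (v^~ i)).
Qed.

Lemma measurable_renewal_coin lam t i : 0 < lam ->
  measurable [set w | renewal_coins lam (E w) t i].
Proof.
move=> lam0.
rewrite (_ : [set w | _] = \bigcup_(v in [set v : {ffun 'I_t.+1 -> bool} | v ord_max])
   [set w | forall s j, (s < t.+1)%N -> j \in [:: i] ->
      renewal_coins lam (E w) s j = v (inord s)]).
  apply: fin_bigcup_measurable => [|v _]; first exact: finite_finset.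
  rewrite (renewal_box_event (fun s _ => v (inord s))) //.
  exact: (measurable_ranges iidE).
apply/seteqP; split=> w /=.
  move=> H; exists [ffun s : 'I_t.+1 => renewal_coins lam (E w) s i].
    by rewrite /= ffunE.
  by move=> s j st; rewrite inE => /eqP ->; rewrite ffunE inordK.
move=> [v /= vt H]; rewrite (H t i) ?inE //.
by rewrite (_ : inord t = ord_max) //; apply/val_inj; rewrite /= inordK.
Qed.

End RenewalLaw.

(** Sums out the coins of [r] one at a time, by [p + (1 - p) = 1]. The renewal law is computed on
    square boxes, and this passes to arbitrary finite sets of coins. *)
Lemma iid_bernoulli_marginal {R : realType} {dsp : measure_display}
    {T : measurableType dsp} (P : probability T R) (X : T -> nat -> nat -> bool)
    (p : R) (s r : seq (nat * nat)) :
  (forall t i, measurable [set w | X w t i]) -> uniq (s ++ r) ->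
  (forall v : nat * nat -> bool,
     P [set w | forall j, j \in s ++ r -> X w j.1 j.2 = v j] =
     (\prod_(j <- s ++ r) (if v j then p else 1 - p))%:E) ->
  forall v : nat * nat -> bool,
     P [set w | forall j, j \in s -> X w j.1 j.2 = v j] =
     (\prod_(j <- s) (if v j then p else 1 - p))%:E.
Proof.
move=> mX; elim: r s => [|j r IH] s; first by rewrite cats0.
rewrite -cat_rcons => ur /(IH _ ur) H v.
have js : j \notin s.
  by move: ur; rewrite cat_uniq rcons_uniq -andbA => /andP[].
pose vb b k := if k == j then b else v k.
pose A b := [set w | forall k, k \in rcons s j -> X w k.1 k.2 = vb b k].
have AE b : A b = [set w | forall k, k \in s -> X w k.1 k.2 = v k] `&`
                  [set w | X w j.1 j.2 = b].
  apply/seteqP; split=> w /=.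
    move=> Hw; split=> [k ks|].
      have := Hw k; rewrite mem_rcons inE ks orbT /vb => /(_ isT) ->.
      by case: eqP js => // <-; rewrite ks.
    by have := Hw j; rewrite mem_rcons inE /vb !eqxx => /(_ isT).
  move=> [Hs Hj] k; rewrite mem_rcons inE /vb.
  by case: eqP => [->|_ /Hs].
have mXb b : measurable [set w | X w j.1 j.2 = b].
  case: b; first exact: mX.
  rewrite (_ : [set w | _] = ~` [set w | X w j.1 j.2]); first exact: measurableC.
  by apply/seteqP; split=> w /= => [->//|/negP/negbTE].
have ms : measurable [set w | forall k, k \in s -> X w k.1 k.2 = v k].
  elim: {H ur js vb A AE} s => [|k s IHs].
    by rewrite (_ : [set w | _] = setT) //; apply/seteqP; split.
  rewrite (_ : [set w | _] = [set w | X w k.1 k.2 = v k] `&`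
      [set w | forall k, k \in s -> X w k.1 k.2 = v k]).
    apply: measurableI => //; case: (v k); first exact: mX.
    rewrite (_ : [set w | _] = ~` [set w | X w k.1 k.2]); first exact: measurableC.
    by apply/seteqP; split=> w /= => [->//|/negP/negbTE].
  apply/seteqP; split=> w /=.
    by move=> Hw; split=> [|l ls]; apply: Hw; rewrite inE ?eqxx // ls orbT.
  by move=> [Hk Hw] l; rewrite inE => /orP[/eqP->|/Hw].
have -> : [set w | forall k, k \in s -> X w k.1 k.2 = v k] = A true `|` A false.
  rewrite !AE; apply/seteqP; split=> w /=; last by case=> -[].
  by move=> Hw; case: (X w j.1 j.2); [left|right].
have mA b : measurable (A b) by rewrite AE; exact: measurableI.
rewrite measureU //; last first.
  by rewrite !AE; apply/seteqP; split=> w //= [[_ ->] [_]].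
have prodE b : \prod_(k <- rcons s j) (if vb b k then p else 1 - p) =
    (if b then p else 1 - p) * \prod_(k <- s) (if v k then p else 1 - p).
  rewrite -cats1 big_cat big_seq1 /= {2}/vb eqxx mulrC; congr (_ * _).
  rewrite big_seq [RHS]big_seq; apply: eq_bigr => k ks; rewrite /vb.
  by case: eqP js => // <-; rewrite ks.
transitivity ((\prod_(k <- rcons s j) (if vb true k then p else 1 - p))%:E +
    (\prod_(k <- rcons s j) (if vb false k then p else 1 - p))%:E)%E.
  by congr (_ + _)%E; exact: H.
by rewrite !prodE -EFinD -mulrDl subrKC mul1r.
Qed.

Lemma iid_renewal_coins {R : realType} {dsp : measure_display} {U : measurableType dsp}
    (Q : probability U R) (E : U -> nat -> nat -> R) (e : R) :
  iid_exp1 Q E -> 0 < e < 1 ->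
  iid_bernoulli Q (fun w => renewal_coins (- ln e) (E w)) (1 - e).
Proof.
move=> iidE e01; have lam0 : 0 < - ln e by rewrite oppr_gt0 ln_lt0.
split=> [t i|s v us]; first exact: (measurable_renewal_coin iidE).
have [n sn] : exists n, forall j, j \in s -> (j.1 < n)%N && (j.2 < n)%N.
  elim: s {us} => [|j s [n IH]]; first by exists 0%N.
  exists (n + j.1 + j.2).+1 => k; rewrite inE => /orP[/eqP->|/IH].
    by case: j => a b /=; lia.
  by case: j k => a b [k l] /=; lia.
pose box := [seq (t, i) | t <- iota 0 n, i <- iota 0 n].
have boxE j : (j \in box) = (j.1 < n)%N && (j.2 < n)%N.
  case: j => a b; apply/allpairsP/idP => /= [[[a' b'] /= []]|/andP[an bn]].
    by rewrite !mem_iota /= !add0n => + + [-> ->] => -> ->.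
  by exists (a, b); rewrite !mem_iota /= !add0n.
have ubox : uniq box by apply: allpairs_uniq; rewrite ?iota_uniq // => -[? ?] [? ?].
pose r := [seq j <- box | j \notin s].
have usr : uniq (s ++ r).
  rewrite cat_uniq us filter_uniq // andbT /=; apply/hasPn => j.
  by rewrite mem_filter => /andP[].
have psr : perm_eq box (s ++ r).
  apply: uniq_perm => // j; rewrite mem_cat mem_filter boxE.
  by have := sn j; case: (j \in s) => //= /(_ isT) ->.
apply: (@iid_bernoulli_marginal _ _ _ Q (fun w => renewal_coins (- ln e) (E w))
  (1 - e) s r) => // [t i|v'].
  exact: (measurable_renewal_coin iidE).
rewrite -(perm_big _ psr) big_allpairs /=.
rewrite (_ : [set w | _] = [set w | forall t i, (t < n)%N -> i \in iota 0 n ->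
      renewal_coins (- ln e) (E w) t i = v' (t, i)]).
  rewrite (renewal_box_prob iidE (fun t i => v' (t, i))) // exchange_big /=.
  congr EFin; apply: eq_bigr => t _; apply: eq_bigr => i _.
  by rewrite opprB subrKC.
apply/seteqP; split=> w /= Hw.
  move=> t i tn; rewrite mem_iota /= add0n => iN.
  by apply: (Hw (t, i)); rewrite -(perm_mem psr) boxE /= tn.
move=> [t i]; rewrite -(perm_mem psr) boxE => /= /andP[tn iN].
by apply: Hw; rewrite // mem_iota.
Qed.

(** * Integrals of functions of the coins *)

Section NullModification.
Context {R : realType} {dsp : measure_display} {T : measurableType dsp}
  (mu : {measure set T -> \bar R}) (N : set T).
Hypotheses (mN : measurable N) (N0 : mu N = 0%E).
Import HBNNSimple.

(** The integral is a supremum over simple functions below [f]. Multiplied by the indicator of the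
    complement of [N], such a function keeps its integral and falls below [g]. *)
Lemma le_nnintegral_null (f g : T -> \bar R) :
  (forall x, 0 <= f x)%E -> (forall x, 0 <= g x)%E ->
  (forall x, ~ N x -> f x = g x) -> (\int[mu]_x f x <= \int[mu]_x g x)%E.
Proof.
move=> f0 g0 fg; rewrite !ge0_integralTE //; apply: ub_ereal_sup => _ [h /= hf <-].
pose h' := proj_nnsfun h (measurableC mN).
have h'E x : h' x = h x * \1_(~` N) x by [].
have -> : sintegral mu h = sintegral mu h'.
  rewrite -!integralT_nnsfun; apply: ae_eq_integral => //.
  - by apply/measurable_EFinP.
  - by apply/measurable_EFinP.
  exists N; split=> // x /= H; apply: contrapT => Nx; apply: H => _.
  have e : h' x = h x by rewrite h'E indicE mem_set // mulr1.
  exact: (congr1 EFin (esym e)).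
apply: ereal_sup_ubound; exists h' => //= x; suff : ((h' x)%:E <= g x)%E by [].
rewrite h'E indicE.
have [Nx|Nx] := pselect (N x).
  by rewrite memNset ?mulr0 //; apply; exact: Nx.
by rewrite mem_set // mulr1 -fg.
Qed.

(* No measurability is required: the integrand [F (pushtasep (E w))] of the limit
   is only controlled on an almost sure event. *)
Lemma integral_null_eq (f g : T -> \bar R) : (forall x, ~ N x -> f x = g x) ->
  (\int[mu]_x f x = \int[mu]_x g x)%E.
Proof.
move=> fg; rewrite integralE [RHS]integralE; congr (_ - _)%E; apply/eqP;
  rewrite eq_le; apply/andP; split; apply: le_nnintegral_null => // x Nx;
  by rewrite ?funeposE ?funenegE fg.
Qed.

End NullModification.

Section BoundedConvergence.
Context {R : realType} {dsp : measure_display} {T : measurableType dsp}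
  (P : probability T R).

Lemma bounded_cvg_Rintegral (f_ : nat -> T -> R) (f : T -> R) (M : R) :
  (forall n, measurable_fun setT (f_ n)) -> (forall n x, `|f_ n x| <= M) ->
  (forall x, f_ n x @[n --> \oo] --> f x) ->
  Rintegral P setT (f_ n) @[n --> \oo] --> Rintegral P setT f.
Proof.
move=> mf_ fM f_f.
have iM : P.-integrable setT (EFin \o cst M) by exact: finite_measure_integrable_cst.
have mEf n : measurable_fun setT (EFin \o f_ n) by exact/measurable_EFinP.
have cE x : setT x -> (EFin \o f_ n) x @[n --> \oo] --> (EFin \o f) x.
  by move=> _; apply/cvg_EFin; [exact: nearW|exact: f_f].
have fE n x : setT x -> (`|(EFin \o f_ n) x| <= (EFin \o cst M) x)%E.
  by move=> _ /=; rewrite lee_fin.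
have mf : measurable_fun setT f by apply: (measurable_fun_cvg mf_) => x _; exact: f_f.
have mEf' : measurable_fun setT (EFin \o f) by exact/measurable_EFinP.
have [If _ cv] := dominated_convergence measurableT mEf mEf' (aeW P cE) iM
  (aeW P (fun x n => fE n x)).
have fin := integrable_fin_num measurableT If.
by apply: fine_cvg; rewrite fineK.
Qed.

Lemma bounded_ae_cvg_Rintegral (f_ : nat -> T -> R) (f : T -> R) (M : R) :
  (forall n, measurable_fun setT (f_ n)) -> (forall n x, `|f_ n x| <= M) ->
  (\forall x \ae P, f_ n x @[n --> \oo] --> f x) ->
  Rintegral P setT (f_ n) @[n --> \oo] --> Rintegral P setT f.
Proof.
move=> mf_ fM [N [mN N0 fN]].
have M0 : 0 <= M by exact: le_trans (fM 0%N point).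
(* Setting everything to 0 on [N] leaves the integrals unchanged and makes the convergence hold
   everywhere, so that the limit becomes measurable. *)
pose r g x : R := g x * \1_(~` N) x.
have rE (g : T -> R) : Rintegral P setT (r g) = Rintegral P setT g.
  congr fine; apply: (integral_null_eq mN) => // x Nx.
  by rewrite /r indicE mem_set // mulr1.
rewrite -rE; under eq_fun do rewrite -rE.
apply: (@bounded_cvg_Rintegral (fun n => r (f_ n)) _ M) => [n|n x|x].
- apply: measurable_funM => //; apply: measurable_indic; exact: measurableC.
- rewrite /r indicE; case: (_ \in _); rewrite ?mulr1 ?mulr0 ?normr0 //.
- have [Nx|Nx] := pselect (N x).
    have r0 g : r g x = 0 by rewrite /r indicE memNset ?mulr0 //; apply; exact: Nx.
    by rewrite r0; under eq_fun do rewrite r0; exact: cvg_cst.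
  have r1 g : r g x = g x by rewrite /r indicE mem_set ?mulr1.
  rewrite r1; under eq_fun do rewrite r1.
  by apply: contrapT => H; apply: Nx; apply: fN.
Qed.

End BoundedConvergence.

(** * Means of functions of the coins, by truncation to finite boxes *)

Section FiniteCoins.
Implicit Types (eta : nat -> nat -> bool).

Definition box_trunc n eta t i : bool := [&& (t < n)%N, (i < n)%N & eta t i].

Definition box_ext n (v : {ffun 'I_n * 'I_n -> bool}) (t i : nat) : bool :=
  [exists j : 'I_n * 'I_n, [&& j.1 == t :> nat, j.2 == i :> nat & v j]].

Lemma box_extE n (v : {ffun 'I_n * 'I_n -> bool}) (j : 'I_n * 'I_n) :
  box_ext v j.1 j.2 = v j.
Proof.
apply/existsP/idP => [[[a b] /= /and3P[/eqP aj /eqP bj]]|vj].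
  by rewrite (val_inj aj) (val_inj bj) -surjective_pairing.
by exists j; rewrite !eqxx.
Qed.

Lemma box_trunc_ext n eta :
  box_trunc n eta = box_ext [ffun j : 'I_n * 'I_n => eta j.1 j.2].
Proof.
apply/funext => t; apply/funext => i; apply/and3P/existsP => [[tn iN eti]|[[a b] /=]].
  by exists (Ordinal tn, Ordinal iN); rewrite /= !eqxx ffunE.
by rewrite ffunE => /and3P[/eqP <- /eqP <-] /=; rewrite !ltn_ord.
Qed.

Definition box_mean {R : realType} (p : R) (f : (nat -> nat -> bool) -> R) n : R :=
  \sum_(v : {ffun 'I_n * 'I_n -> bool})
     f (box_ext v) * \prod_j (if v j then p else 1 - p).

Context {R : realType} {dsp : measure_display} {T : measurableType dsp}
  (P : probability T R) (X : T -> nat -> nat -> bool) (p : R)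
  (iidX : iid_bernoulli P X p).

Let cyl n (v : {ffun 'I_n * 'I_n -> bool}) :=
  [set w | forall j : 'I_n * 'I_n, X w j.1 j.2 = v j].

Let measurable_cyl n (v : {ffun 'I_n * 'I_n -> bool}) : measurable (cyl v).
Proof.
rewrite (_ : cyl v = \bigcap_(j in [set: 'I_n * 'I_n]) [set w | X w j.1 j.2 = v j]).
  apply: fin_bigcap_measurable => [|j _]; first exact: finite_finset.
  case: iidX => mX _; case: (v j); first exact: mX.
  rewrite (_ : [set w | _] = ~` [set w | X w j.1 j.2]); first exact: measurableC.
  by apply/seteqP; split=> w /= => [->//|/negP/negbTE].
by apply/seteqP; split=> w /= => [H j _|H j]; exact: H.
Qed.

Let prob_cyl n (v : {ffun 'I_n * 'I_n -> bool}) :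
  P (cyl v) = (\prod_j (if v j then p else 1 - p))%:E.
Proof.
pose s := [seq (nat_of_ord j.1, nat_of_ord j.2) | j <- enum {: 'I_n * 'I_n}].
have us : uniq s.
  by rewrite map_inj_uniq ?enum_uniq // => -[a b] [c d] [/val_inj -> /val_inj ->].
rewrite (_ : cyl v = [set w | forall j, j \in s -> X w j.1 j.2 = box_ext v j.1 j.2]).
  have [_ ->] := iidX; last by [].
  congr EFin; rewrite big_map big_enum /=; apply: eq_bigr => j _.
  by rewrite box_extE.
apply/seteqP; split=> w /= H.
  by move=> _ /mapP[j _ ->] /=; rewrite box_extE; exact: H.
move=> j; rewrite -box_extE; apply: (H (nat_of_ord j.1, nat_of_ord j.2)).
by apply/mapP; exists j; rewrite ?mem_enum.
Qed.

(** A truncated array takes finitely many values, so [f] of it is a simple function for any [f]. *)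
Let trunc_sum (f : (nat -> nat -> bool) -> R) n w : f (box_trunc n (X w)) =
  \sum_(v : {ffun 'I_n * 'I_n -> bool}) f (box_ext v) * \1_(cyl v) w.
Proof.
pose v0 := [ffun j : 'I_n * 'I_n => X w j.1 j.2].
rewrite box_trunc_ext (bigD1 v0) //= big1 ?addr0.
  by rewrite indicE mem_set ?mulr1 // => j; rewrite ffunE.
move=> v vv0; rewrite indicE memNset ?mulr0 // => H.
by case/eqP: vv0; apply/ffunP => j; rewrite ffunE H.
Qed.

Let measurable_trunc (f : (nat -> nat -> bool) -> R) n :
  measurable_fun setT (fun w => f (box_trunc n (X w))).
Proof.
under eq_fun do rewrite trunc_sum.
by apply: measurable_sum => v; apply: measurable_funM.
Qed.

Let Rintegral_trunc f n :
  Rintegral P setT (fun w => f (box_trunc n (X w))) = box_mean p f n.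
Proof.
rewrite /Rintegral; under eq_integral do rewrite trunc_sum -sumEFin.
have icyl (v : {ffun 'I_n * 'I_n -> bool}) :
    P.-integrable setT (EFin \o (\1_(cyl v) : T -> R)).
  apply: measurable_bounded_integrable => //.
  - by rewrite (le_lt_trans (probability_le1 _ _)) ?ltry.
  - exists 1; split=> // y y1 w _; rewrite /= (le_trans _ (ltW y1)) // indicE.
    by case: (_ \in _); rewrite ?normr1 ?normr0.
rewrite integral_sum //; last first.
  move=> v; have := integrableZl measurableT (f (box_ext v)) (icyl v).
  by congr (_.-integrable _ _); apply/funext => w; rewrite /= EFinM.
rewrite (eq_bigr (fun v => (f (box_ext v) * \prod_j (if v j then p else 1 - p))%:E)).
  by rewrite sumEFin.
move=> v _; under eq_integral do rewrite EFinM.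
rewrite integralZl //; last exact: icyl.
rewrite integral_indic //= setIT EFinM; congr (_ * _)%E.
exact: prob_cyl.
Qed.

(** [box_mean] mentions neither the space nor [X]: arrays of coins with the same success probability
    give [f] the same mean, wherever they live. *)
Lemma Rintegral_coins (f : (nat -> nat -> bool) -> R) (M : R) :
  (forall eta, `|f eta| <= M) ->
  (forall eta, f (box_trunc n eta) @[n --> \oo] --> f eta) ->
  measurable_fun setT (fun w => f (X w)) /\
  box_mean p f n @[n --> \oo] --> Rintegral P setT (fun w => f (X w)).
Proof.
move=> fM ff; split.
  apply: (@measurable_fun_cvg _ _ _ _ (fun n w => f (box_trunc n (X w)))) => [n|w _].
    exact: measurable_trunc.
  exact: (ff (X w)).
under eq_fun do rewrite -Rintegral_trunc.
by apply: (@bounded_cvg_Rintegral _ _ _ _ (fun n w => f (box_trunc n (X w))) _ M).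
Qed.

End FiniteCoins.

(** * Regularity of the rescaled SBBS path *)

Section ScaledPath.
Context {R : realType} (c : option nat) (d : nat) (z0 : nat -> bool) (e : R).
Hypotheses (e01 : 0 < e < 1) (z0_balls : has_d_balls z0 d).

Lemma sbbs_scaled_cadlag eta : cadlag (sbbs_scaled (d := d) c z0 e eta).
Proof.
have a0 : 0 < 1 - e by case/andP: e01 => _; rewrite subr_gt0.
set a := 1 - e in a0 *.
have trE t n : n%:R * a <= t -> t < n.+1%:R * a -> Num.truncn (t / a) = n.
  by move=> h1 h2; apply: truncn_def; rewrite ler_pdivlMr // ltr_pdivrMr // h1.
have pathE s t : Num.truncn (s / a) = Num.truncn (t / a) ->
    sbbs_scaled (d := d) c z0 e eta s = sbbs_scaled c z0 e eta t.
  by move=> h; apply/funext => i; rewrite /sbbs_scaled -/a h.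
move=> t t0; have ta0 : 0 <= t / a by rewrite divr_ge0 // ltW.
have /andP[] := truncn_itv ta0; set n := Num.truncn (t / a).
rewrite ler_pdivlMr // ltr_pdivrMr // => nt tn; split.
  exists (n.+1%:R * a - t); first by rewrite subr_gt0.
  move=> s ts; rewrite subrKC => sn; apply: pathE; rewrite -/n; apply: trE => //.
  exact: le_trans ts.
(* At a grid point the left limit is the value on the previous cell; elsewhere the path is constant
   around [t]. *)
move=> t_gt0; move: nt; rewrite le_eqVlt => /orP[/eqP nt|nt].
  have n0 : (0 < n)%N by rewrite lt0n; apply: contraTneq t_gt0 => n0; rewrite -nt n0 mul0r ltxx.
  exists a => //; exists (sbbs_scaled c z0 e eta (n.-1%:R * a)) => s ts st.
  have nE : n%:R = n.-1%:R + 1 :> R by rewrite natr1 prednK.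
  apply: pathE; rewrite (trE s n.-1) ?(trE (n.-1%:R * a) n.-1) //.
  - by rewrite ltr_pM2r // ltr_nat.
  - by move: ts; rewrite -nt nE mulrDl mul1r addrK => /ltW.
  - by rewrite prednK // nt.
exists (t - n%:R * a); first by rewrite subr_gt0.
exists (sbbs_scaled c z0 e eta t) => s; rewrite subKr => ns st.
by apply: pathE; rewrite -/n; apply: trE; [exact: ltW|exact: lt_trans tn].
Qed.

(** Up to time [K] the path reads only the coins of [d] balls in the first [K / (1 - e)] sweeps, so
    for large [n] the two paths coincide there. *)
Lemma sbbs_scaled_box_trunc eta :
  J1_conv (fun n => sbbs_scaled (d := d) c z0 e (box_trunc n eta))
          (sbbs_scaled c z0 e eta).
Proof.
apply: J1_convI => K; near=> n; exists id; split=> [|s t _ ts|t t0 tK].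
- split=> //; split=> //; split; last by move=> y y0; exists y.
  by apply: continuous_subspaceT => x; exact: cvg_id.
- by rewrite divff ?ln1 ?normr0 ?invr_ge0 // subr_eq0 gt_eqF.
apply/funext => i; rewrite /sbbs_scaled.
have a0 : 0 < 1 - e by case/andP: e01 => _; rewrite subr_gt0.
have zd := nballs_le_positions (has_d_balls_positions z0_balls).
rewrite (@eq_sbbs_traj c _ eta z0 d _ zd) // => s j st jd; rewrite /box_trunc.
have -> : (s < n)%N.
  apply: (@leq_trans (Num.truncn (K%:R / (1 - e)))); last by near: n; exact: nbhs_infty_ge.
  by apply: leq_trans st _; apply: le_truncn; rewrite ler_pM2r // invr_gt0.
have -> // : (j < n)%N by apply: (leq_trans jd); near: n; exact: nbhs_infty_ge.
Unshelve. all: by end_near. Qed.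

End ScaledPath.

(** * Almost sure properties of the clocks *)

Section AlmostSure.
Context {R : realType} {dsp : measure_display} {U : measurableType dsp}
  (Q : probability U R) (E : U -> nat -> nat -> R) (iidE : iid_exp1 Q E).

Lemma null_bigcap (A : nat -> set U) : (forall n, measurable (A n)) ->
  (forall del : R, 0 < del -> exists n, (Q (A n) <= del%:E)%E) ->
  Q (\bigcap_n A n) = 0%E.
Proof.
move=> mA QA; have mI : measurable (\bigcap_n A n) by exact: bigcapT_measurable.
apply/eqP; rewrite -measure_le0; apply/lee_addgt0Pr => del /QA[n An].
rewrite add0e; apply: le_trans An; apply: le_measure; rewrite ?inE //.
by move=> w; exact.
Qed.

Lemma exp1_le_prob (s : seq (nat * nat)) (a : R) : uniq s ->
  Q [set w | forall j, j \in s -> E w j.1 j.2 <= a] = (exp1_cdf a ^+ size s)%:E.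
Proof.
case: iidE => _ H us; rewrite (H s (fun=> a) us) big_const_seq count_predT.
by rewrite -Monoid.iteropE.
Qed.

Lemma measurable_exp1_le (s : seq (nat * nat)) (a : R) :
  measurable [set w | forall j, j \in s -> E w j.1 j.2 <= a].
Proof.
have := measurable_ranges iidE s (fun=> (None, Some a)).
by rewrite /in_range.
Qed.

Lemma ae_exp1_gt0 : \forall w \ae Q, forall i k, 0 < E w i k.
Proof.
apply: ae_foralln => i; apply: ae_foralln => k.
exists [set w | forall j, j \in [:: (i, k)] -> E w j.1 j.2 <= 0]; split.
- exact: measurable_exp1_le.
- apply: (etrans (exp1_le_prob (s := [:: (i, k)]) 0 isT)).
  by rewrite /exp1_cdf ltxx oppr0 expR0 subrr expr1.
- move=> w /= /negP; rewrite -leNgt => Ew j; rewrite inE => /eqP ->; exact: Ew.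
Qed.

(** A stretch of [n] holding times stays below 1 with probability [q ^ n], which tends to 0.
    Infinitely many holding times above 1 suffice for the ring times to diverge. *)
Lemma ae_exp1_large : \forall w \ae Q, forall i K, exists2 k, (K <= k)%N & 1 < E w i k.
Proof.
apply: ae_foralln => i; apply: ae_foralln => K.
pose A n := [set w | forall j, j \in [seq (i, k) | k <- iota K n] -> E w j.1 j.2 <= 1].
exists (\bigcap_n A n); split.
- by apply: bigcapT_measurable => n; exact: measurable_exp1_le.
- apply: null_bigcap => [n|del del0]; first exact: measurable_exp1_le.
  pose q : R := exp1_cdf 1.
  have qE : q = 1 - expR (- 1) by rewrite /q /exp1_cdf ltNge ler01.
  have q0 : 0 <= q by rewrite qE subr_ge0 -[leRHS]expR0 ler_expR oppr_le0.
  have q1 : `|q| < 1 by rewrite ger0_norm // qE gtrBl expR_gt0.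
  have /cvgrPdist_le /(_ _ del0) [n _ /(_ n (leqnn n)) /=] := cvg_expr q1.
  rewrite sub0r normrN ger0_norm ?exprn_ge0 // => qn; exists n.
  rewrite /A exp1_le_prob ?size_map ?size_iota ?lee_fin //.
  by rewrite map_inj_uniq ?iota_uniq // => a b [].
- move=> w /= H n _ j /mapP[k]; rewrite mem_iota => /andP[Kk _] -> /=.
  by rewrite leNgt; apply/negP => Ek; apply: H; exists k.
Qed.

Lemma ring_time_unbounded (x : nat -> nat -> R) i : (forall k, 0 < x i k) ->
  (forall K, exists2 k, (K <= k)%N & 1 < x i k) ->
  forall M, exists n, M < ring_time x i n.
Proof.
move=> x0 x1.
have ex (N : nat) : exists n, N%:R <= ring_time x i n.
  elim: N => [|N [n IH]]; first by exists 0%N; apply: sumr_ge0 => k _; exact: ltW.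
  have [k nk xk] := x1 n.+1; exists k.
  rewrite /ring_time big_ord_recr /= -natr1 lerD //; last exact: ltW.
  apply: (le_trans IH); rewrite /ring_time -(subnKC nk) big_split_ord /= lerDl.
  by apply: sumr_ge0 => l _; exact: ltW.
move=> M; have [n nP] := ex (Num.truncn M).+1; exists n.
by apply: lt_le_trans nP; exact: truncnS_gt.
Qed.

Section Ties.
Context (i j m l M : nat) (ij : i != j).

(* A tie forces the renewal coins of [i] and [j] to come up within [K] steps of
   each other before step [L N]; as the coins are independent with success
   probability [q = 1 / (N + 2)], the union bound gives [O(q)]. *)
Let q N : R := N.+2%:R^-1.
Let K := (M + M + m + l + 2)%N.
Let L N := ((M + M + m + 2) * N.+2)%N.
Let coin N w := renewal_coins (- ln (1 - q N)) (E w).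
(** One index [k] encodes a pair: the quotient is the step of the coin of [i], the remainder minus
    [K] is the delay of the coin of [j], between [- K] and [K]. *)
Let F N k := [set w | coin N w (k %/ (K + K).+1) i &&
                      coin N w (k %/ (K + K).+1 + k %% (K + K).+1 - K) j].

Let q_gt0 N : 0 < q N. Proof. by rewrite invr_gt0. Qed.

Let q01 N : 0 < 1 - q N < 1.
Proof. by rewrite subr_gt0 gtrBl q_gt0 andbT invf_lt1 ?ltr1n. Qed.

Let measurable_F N k : measurable (F N k).
Proof.
have [mC _] := iid_renewal_coins iidE (q01 N).
rewrite (_ : F N k = [set w | coin N w (k %/ (K + K).+1) i] `&`
  [set w | coin N w (k %/ (K + K).+1 + k %% (K + K).+1 - K) j]).
  by apply: measurableI; exact: mC.
by apply/seteqP; split=> w; [case/andP|move=> [? ?]; apply/andP].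
Qed.

Let prob_F N k : Q (F N k) = (q N ^+ 2)%:E.
Proof.
have [_ H] := iid_renewal_coins iidE (q01 N).
set a := (k %/ (K + K).+1)%N; set b := (a + k %% (K + K).+1 - K)%N.
have us : uniq [:: (a, i); (b, j)].
  by rewrite /= inE xpair_eqE negb_and ij orbT.
have := H _ (fun=> true) us; rewrite !big_cons big_nil mulr1 subKr -expr2 => <-.
congr (Q _); apply/seteqP; split=> w /=.
  by move=> /andP[h1 h2] p; rewrite !inE => /orP[] /eqP ->.
move=> Hw; apply/andP; split; first by apply: (Hw (a, i)); rewrite inE eqxx.
by apply: (Hw (b, j)); rewrite !inE eqxx orbT.
Qed.

Let tie_coins N w : (forall k, 0 < E w i k) -> (forall k, 0 < E w j k) ->
  ring_time (E w) i m = ring_time (E w) j l -> ring_time (E w) i m <= M%:R ->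
  exists2 k, (k < L N * (K + K).+1)%N & F N k w.
Proof.
move=> Ei Ej tie SM; set S := ring_time (E w) i m in tie SM.
have lam0 : 0 < - ln (1 - q N) by rewrite oppr_gt0 ln_lt0 // q01.
pose D := firing (- ln (1 - q N)) (E w i) m.+1.
pose D' := firing (- ln (1 - q N)) (E w j) l.+1.
have D0 : (0 < D)%N by rewrite /D firingS addn_gt0 gap_gt0 // orbT.
have D'0 : (0 < D')%N by rewrite /D' firingS addn_gt0 gap_gt0 // orbT.
have S0 : 0 <= S by apply: sumr_ge0 => k _; exact: ltW.
have := firing_bound m.+1 (q01 N) Ei.
rewrite subKr -/D (_ : \sum_(k < m.+1) E w i k = S) // => bD.
have := firing_bound l.+1 (q01 N) Ej.
rewrite subKr -/D' (_ : \sum_(k < l.+1) E w j k = S) // => bD'.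
have q0 := q_gt0 N.
have Nq : N.+2%:R * q N = 1 by rewrite mulfV.
have qS : q N * S <= q N * M%:R by rewrite ler_pM2l.
(* [firing_bound] puts [q N * D] within [q N * (M + m.+1)] of [S], and [q N * D'] within
   [q N * (M + l.+1)]; the sum of the errors divided by [q N] is [K]. *)
have DD' : (D <= D' + K)%N && (D' <= D + K)%N.
  move: bD bD'; rewrite !ler_norml => /andP[h1 h2] /andP[h3 h4].
  have nE (x : nat) : x.+1%:R = x%:R + 1 :> R by rewrite natr1.
  rewrite !nE in h1 h2 h3 h4.
  apply/andP; split; rewrite -(ler_nat R) -(ler_pM2l q0) /K !natrD; lra.
(* Likewise [q N * D] is at most [M + M + m.+1], below the first factor of [L N]; the factor [N.+2]
   is the inverse of [q N]. *)
have DL : (D <= L N)%N.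
  move: bD; rewrite ler_norml => /andP[_ h2].
  rewrite -(ler_nat R) -(ler_pM2l q0) /L natrM mulrCA [q N * N.+2%:R]mulrC Nq mulr1.
  have q1 : q N <= 1 by rewrite invf_le1 // ler1n.
  have qM : q N * M%:R <= M%:R by rewrite ler_piMl.
  have qm : q N * m%:R <= m%:R by rewrite ler_piMl.
  by rewrite !natrD; move: h2; rewrite -(natr1 m); lra.
case/andP: DD' => DD' D'D.
have dK : (D'.-1 + K - D.-1 < (K + K).+1)%N by lia.
exists (D.-1 * (K + K).+1 + (D'.-1 + K - D.-1))%N.
  apply: (@leq_trans (D.-1.+1 * (K + K).+1)); last by rewrite leq_mul2r prednK // DL orbT.
  by rewrite mulSn addnC ltn_add2r.
rewrite /F /= divnMDl // divn_small // modnMDl modn_small // addn0.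
have -> : (D.-1 + (D'.-1 + K - D.-1) - K = D'.-1)%N by lia.
apply/andP; split.
  by apply/(renewal_coinP lam0 Ei); exists m; rewrite -/D prednK.
by apply/(renewal_coinP lam0 Ej); exists l; rewrite -/D' prednK.
Qed.

(** The bound [M] keeps the number of steps to inspect finite; [ae_no_ties] removes it by letting
    [M] run over the integers. *)
Lemma negligible_tie : Q.-negligible [set w | [/\ forall k, 0 < E w i k,
  forall k, 0 < E w j k, ring_time (E w) i m = ring_time (E w) j l &
  ring_time (E w) i m <= M%:R]].
Proof.
pose A N := \big[setU/set0]_(k < L N * (K + K).+1) F N k.
have mA N : measurable (A N) by apply: bigsetU_measurable => k _; exact: measurable_F.
exists (\bigcap_N A N); split.
- exact: bigcapT_measurable.
- apply: null_bigcap => // del del0.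
  (* There are [C * N.+2] indices [k], each of probability [q N ^ 2], and [N.+2 * q N = 1], so the
     union bound gives [C * q N]. *)
  pose C := ((M + M + m + 2) * (K + K).+1)%N.
  exists (Num.truncn (C%:R / del)); set N := Num.truncn _.
  have CN : C%:R * q N <= del.
    rewrite ler_pdivrMr // mulrC -ler_pdivrMr // (le_trans (ltW (truncnS_gt _))) //.
    by rewrite ler_nat.
  apply: (@le_trans _ _ (\sum_(k < L N * (K + K).+1) Q (F N k))%E).
    by apply: content_subadditive => // k _; exact: measurable_F.
  rewrite (eq_bigr (fun=> (q N ^+ 2)%:E)); last by move=> k _; exact: prob_F.
  rewrite sumEFin lee_fin sumr_const card_ord -mulr_natl.
  suff -> : (L N * (K + K).+1)%:R * q N ^+ 2 = C%:R * q N by [].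
  rewrite /L mulnAC -/C natrM expr2 -mulrA [N.+2%:R * _]mulrA mulfV ?mul1r //.
- move=> w [Ei Ej tie SM] N _; have [k kn Fk] := tie_coins N Ei Ej tie SM.
  by rewrite /A -bigcup_mkord; exists k.
Qed.

End Ties.

Lemma ae_no_ties : \forall w \ae Q, forall i j m l, i != j ->
  ring_time (E w) i m != ring_time (E w) j l.
Proof.
have ae_tie i j m l M : \forall w \ae Q, i != j ->
    ~ [/\ forall k, 0 < E w i k, forall k, 0 < E w j k,
       ring_time (E w) i m = ring_time (E w) j l & ring_time (E w) i m <= M%:R].
  have [->|ij] := eqVneq i j; first exact: aeW.
  by apply: negligibleS (negligible_tie m l M ij) => w /= H; apply: contrapT => N; apply: H.
have : \forall w \ae Q, forall i j m l M, i != j ->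
    ~ [/\ forall k, 0 < E w i k, forall k, 0 < E w j k,
       ring_time (E w) i m = ring_time (E w) j l & ring_time (E w) i m <= M%:R].
  by do 5![apply: ae_foralln => ?]; exact: ae_tie.
have := ae_exp1_gt0; apply: filterS2 => w E0 H i j m l ij; apply/eqP => tie.
apply: (H i j m l (Num.truncn (ring_time (E w) i m)).+1 ij); split=> //.
by apply/ltW/truncnS_gt.
Qed.

End AlmostSure.

Theorem theorem2p1 (R : realType) (c : option nat) (d : nat) (z0 : nat -> bool)
  (dsp : measure_display) (T : R -> measurableType dsp)
  (P : forall e : R, probability (T e) R)
  (eta : forall e : R, T e -> nat -> nat -> bool)
  (dsp' : measure_display) (U : measurableType dsp') (Q : probability U R)
  (E : U -> nat -> nat -> R) :
  (forall n, c = Some n -> (0 < n)%N) ->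
  (0 < d)%N ->
  has_d_balls z0 d ->
  (forall e : R, 0 < e < 1 -> iid_bernoulli (P e) (eta e) (1 - e)) ->
  iid_exp1 Q E ->
  forall F : (R -> 'I_d -> int) -> R, D_bounded_continuous F ->
    (fun e : R => Rintegral (P e) setT
        (fun w => F (@sbbs_scaled R c d z0 e (eta e w))))
      @ 1^'- -->
    Rintegral Q setT
      (fun w => F (@pushtasep R d (E w) (fun j => (ball_pos z0 j)%:Z))).
Proof.
move=> c_gt0 d_gt0 z0_balls iid_eta iidE F [[M FM] Fcont].
have c0 : below_cap c 0 by case: c c_gt0 => //= n; exact.
pose f e eta' := F (sbbs_scaled (d := d) c z0 e eta').
have fM e eta' : 0 < e < 1 -> `|f e eta'| <= M.
  by move=> e01; apply: FM; exact: sbbs_scaled_cadlag.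
have f_trunc e eta' : 0 < e < 1 -> f e (box_trunc n eta') @[n --> \oo] --> f e eta'.
  move=> e01; apply: Fcont => [n| |]; [exact: sbbs_scaled_cadlag..|].
  exact: sbbs_scaled_box_trunc.
pose X e w := renewal_coins (- ln e) (E w).
(* Both integrals are the limit of the same [box_mean]; this moves the SBBS to the space of the
   clocks. *)
have same_law e : 0 < e < 1 -> Rintegral (P e) setT (fun w => f e (eta e w)) =
    Rintegral Q setT (fun w => f e (X e w)).
  move=> e01.
  have [_ h1] := Rintegral_coins (iid_eta e e01) (fM e ^~ e01) (f_trunc e ^~ e01).
  have [_ h2] := Rintegral_coins (iid_renewal_coins iidE e01) (fM e ^~ e01) (f_trunc e ^~ e01).
  exact: (cvg_unique _ h1 h2).
apply/cvg_at_leftP => u [u1 ucvg].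
(* At most finitely many [u n] are nonpositive; the value [1/2] only keeps [v n] between 0 and 1
   there. *)
pose v n := if 0 < u n then u n else 2^-1.
have v01 n : 0 < v n < 1.
  by rewrite /v; case: ifP => [->|_]; rewrite ?u1 //; lra.
have uv : \forall n \near \oo, u n = v n.
  near=> n; rewrite /v ifT //; near: n.
  by apply: (cvgr_gt _ ucvg).
have vcvg : v @ \oo --> (1 : R) by apply: cvg_trans ucvg; exact: near_eq_cvg.
suff : Rintegral Q setT (fun w => f (v n) (X (v n) w)) @[n --> \oo] -->
    Rintegral Q setT (fun w => F (@pushtasep R d (E w) (fun j => (ball_pos z0 j)%:Z))).
  apply: cvg_trans; apply: near_eq_cvg; near=> n.
  rewrite -same_law //.
  by have -> : u n = v n by near: n.
(* A single sample of clocks now serves all [n], so the convergence can be checked path by path,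
   with [M] as dominating constant. *)
apply: (@bounded_ae_cvg_Rintegral _ _ _ _ _ _ M) => [n|n w|].
- exact: (Rintegral_coins (iid_renewal_coins iidE (v01 n)) (fM _ ^~ (v01 n))
    (f_trunc _ ^~ (v01 n))).1.
- exact: fM.
have := ae_exp1_large iidE; have := ae_no_ties iidE; have := ae_exp1_gt0 iidE.
apply: filterS3 => w E0 nt E1.
have Ed i k : (i < d)%N -> 0 < E w i k by [].
have ntd i j m n : (i < d)%N -> (j < d)%N -> i != j ->
    ring_time (E w) i m != ring_time (E w) j n by move=> _ _; exact: nt.
have unb i (B : R) : (i < d)%N -> exists n, B < ring_time (E w) i n.
  by move=> _; exact: ring_time_unbounded.
apply: Fcont => [n| |]; first exact: sbbs_scaled_cadlag.
  exact: pushtasep_cadlag.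
exact: J1_conv_events.
Unshelve. all: by end_near. Qed.
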